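(* Let $(\mathcal A,\phi,\phi_2)$ with $\mathcal A=\mathbb C[x]$ be the second order probability space of the (second order) semi-circular operator $x$ and let $a=x^2$. Then, as formal power series in $z,w$, \[ \sum_{p,q\ge1}\kappa_{p,q}(a,\dots,a)\,z^pw^q=\frac{zw}{(1-z-w)^2}=\sum_{p,q\ge1}p\binom{p+q-1}{p}z^pw^q . \]
   Context: The space: $\mathcal A=\mathbb C[x]$; $\phi:\mathcal A\to\mathbb C$ is linear with $\phi(1)=1$, $\phi(x^{2k-1})=0$, $\phi(x^{2k})=\frac1{k+1}\binom{2k}{k}$ for $k\ge1$; $\phi_2:\mathcal A\times\mathcal A\to\mathbb C$ is bilinear with $\phi_2(x^m,x^n)=0$ if $m=0$ or $n=0$ or $m+n$ is odd, and, for $m,n\ge 1$ with $m+n$ even, $\phi_2(x^m,x^n)=\sum_{k\ge1}k\binom{m}{(m-k)/2}\binom{n}{(n-k)/2}$, where a binomial coefficient is $0$ if its lower entry is not a non-negative integer. Permutations. $[n]=\{1,\dots,n\}$; $\#(\pi)$ is the number of cycles of $\pi$. $\gamma_n=(1,2,\dots,n)$, $\gamma_{p,q}=(1,\dots,p)(p+1,\dots,p+q)$. $NC(n)$ is the set of non-crossing partitions of $[n]$, identified with the permutations whose cycles are the blocks listed in increasing order. $NC(p)\times NC(q)$ is the set of $\pi=\pi_1\times\pi_2\in S_{p+q}$ with $\pi_1$ a non-crossing permutation of $[p]$ and $\pi_2$ one of $\{p+1,\dots,p+q\}$. $S_{NC}(p,q)$ is the set of $\pi\in S_{p+q}$ such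 that some cycle of $\pi$ meets both $[p]$ and $\{p+1,\dots,p+q\}$ and $\#(\pi)+\#(\pi^{-1}\gamma_{p,q})+\#(\gamma_{p,q})=p+q+2$. Partitioned permutations. A partitioned permutation of $[n]$ is a pair $(\mathcal V,\pi)$ with $\mathcal V$ a partition of $[n]$, $\pi\in S_n$ and every cycle of $\pi$ contained in a block of $\mathcal V$. $0_\pi$ is the partition into cycles of $\pi$; $\pi\in S_{NC}(p,q)$ is identified with $(0_\pi,\pi)$. $\mathcal{PS}_{NC}(p,q)'$ is the set of $(\mathcal V,\pi)$ with $\pi=\pi_1\times\pi_2\in NC(p)\times NC(q)$ such that every block of $\mathcal V$ except one contains exactly one cycle of $\pi$, and the exceptional block contains exactly two, one of $\pi_1$ and one of $\pi_2$. $\mathcal{PS}_{NC}(p,q)=S_{NC}(p,q)\cup\mathcal{PS}_{NC}(p,q)'$. Cumulants. The multilinear functionals $\kappa_n$ are defined recursively by $\phi(a_1\cdots a_n)=\sum_{\pi\in NC(n)}\kappa_\pi(a_1,\dots,a_n)$, and the $(p+q)$-linear functionals $\kappa_{p,q}$ recursively by $\phi_2(a_1\cdots a_p,a_{p+1}\cdots a_{p+q})=\sum_{(\mathcal V,\pi)\in\mathcal{PS}_{NC}(p,q)}\kappa_{(\mathcal V,\pi)}(a_1,\dots,a_{p+q})$. Here $\kappa_\pi=\prod_c\kappa_c$ over the cycles $c=(i_1,\dots,i_m)$ of $\pi$, with $\kappa_c(a_1,\dots)=\kappa_m(a_{i_1},\dots,a_{i_m})$, and $\kappa_{(\mathcal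 V,\pi)}=\prod_{V\in\mathcal V}\kappa_V$, where $\kappa_V=\kappa_c$ if $V$ contains one cycle $c$ of $\pi$, and $\kappa_V=\kappa_{m,l}(a_{i_1},\dots,a_{i_m},a_{j_1},\dots,a_{j_l})$ if $V$ contains two cycles, $(i_1,\dots,i_m)$ in $[p]$ and $(j_1,\dots,j_l)$ in $\{p+1,\dots,p+q\}$. In $\kappa_{p,q}(a,\dots,a)$ all $p+q$ arguments equal $a$. *)

(* Defs.v *)
(* The complex numbers are R[i] for R : realType. *)
From HB Require Import structures.
From mathcomp Require Import all_boot all_order all_fingroup all_algebra.
From mathcomp Require Import complex reals.
From mathcomp Require Import zify.

Set Implicit Arguments.
Unset Strict Implicit.
Unset Printing Implicit Defensive.

Import GRing.Theory.
Local Open Scope ring_scope.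

(* Throughout, [n] = {1, ..., n} is encoded as 'I_n = {0, ..., n-1}. *)

Section Permutations.

Definition gamma (n : nat) : 'S_n := perm (@ordS_inj n).

Definition perm_sum_fun (p q : nat) (s : 'S_p) (t : 'S_q) (i : 'I_(p + q)) :
    'I_(p + q) :=
  match split i with inl j => lshift q (s j) | inr k => rshift p (t k) end.

Fact perm_sum_inj (p q : nat) (s : 'S_p) (t : 'S_q) :
  injective (perm_sum_fun s t).
Proof.
have spl (j : 'I_p) : split (lshift q j) = inl j := unsplitK (inl j).
have spr (k : 'I_q) : split (rshift p k) = inr k := unsplitK (inr k).
move=> i j; rewrite /perm_sum_fun => eq_ij.
rewrite -(splitK i) -(splitK j); congr unsplit; move: eq_ij.
case: (split i) => x; case: (split j) => y /(congr1 (@split p q));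
  by rewrite ?spl ?spr // => -[] /perm_inj ->.
Qed.

(* The permutation s x t of {1, ..., p + q}: s acts on the first p points and
   t on the last q points. *)
Definition perm_sum (p q : nat) (s : 'S_p) (t : 'S_q) : 'S_(p + q) :=
  perm (@perm_sum_inj p q s t).

Definition gamma2 (p q : nat) : 'S_(p + q) := perm_sum (gamma p) (gamma q).

Definition lpart (p q : nat) : {set 'I_(p + q)} := [set lshift q i | i : 'I_p].
Definition rpart (p q : nat) : {set 'I_(p + q)} := [set rshift p i | i : 'I_q].

(* The cycle of s supported by c \in porbits s, written (i, s i, s (s i), ...)
   from its least element i (enum c is increasing). *)
Definition cycle_seq (n : nat) (s : 'S_n) (c : {set 'I_n}) : seq 'I_n :=
  if enum c is i :: _ then traject s i #|c| else [::].

Definition noncrossing (n : nat) (P : {set {set 'I_n}}) : bool :=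
  [forall B in P, forall D in P, (B != D) ==>
    ~~ [exists i in B, exists j in D, exists k in B, exists l in D,
          [&& i < j, j < k & k < l]%N]].

(* NC(n), as the permutations whose cycles, listed increasingly, are the blocks
   of a non-crossing partition. *)
Definition NC (n : nat) : {set 'S_n} :=
  [set s : 'S_n | noncrossing (porbits s) &&
    [forall c in porbits s,
       sorted ltn [seq nat_of_ord i | i <- cycle_seq s c]]].

Definition NC2 (p q : nat) : {set 'S_(p + q)} :=
  [set perm_sum s t | s in NC p, t in NC q].

(* Permutations compose from left to right in MathComp, so that the usual
   s^-1 gamma (gamma first) is gamma * s^-1. *)
Definition S_NC (p q : nat) : {set 'S_(p + q)} :=
  [set s : 'S_(p + q) |
    [exists c in porbits s,
       (c :&: lpart p q != set0) && (c :&: rpart p q != set0)] &&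
    (#|porbits s| + #|porbits (gamma2 p q * s^-1)%g| + #|porbits (gamma2 p q)|
       == p + q + 2)%N].

Definition partitioned_perm (n : nat) (x : {set {set 'I_n}} * 'S_n) : bool :=
  partition x.1 [set: 'I_n] &&
  [forall c in porbits x.2, exists B in x.1, c \subset B].

Definition cycles_in (n : nat) (s : 'S_n) (B : {set 'I_n}) : {set {set 'I_n}} :=
  [set c in porbits s | c \subset B].

Definition PS_NC' (p q : nat) :
    {set {set {set 'I_(p + q)}} * 'S_(p + q)} :=
  [set x : {set {set 'I_(p + q)}} * 'S_(p + q) |
    [&& x.2 \in NC2 p q,
        partitioned_perm x &
        [exists B in x.1,
          [&& #|cycles_in x.2 B| == 2,
              #|[set c in cycles_in x.2 B | c \subset lpart p q]| == 1,
              #|[set c in cycles_in x.2 B | c \subset rpart p q]| == 1 &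
              [forall D in x.1, (D != B) ==> (#|cycles_in x.2 D| == 1)]]]]]%N.

Definition PS_NC (p q : nat) : {set {set {set 'I_(p + q)}} * 'S_(p + q)} :=
  [set (porbits s, s) | s in S_NC p q] :|: PS_NC' p q.

End Permutations.

(* The family (kappa_n)_n is given as one function of the list of the n
   arguments, and (kappa_{p,q})_{p,q} as one function of the two lists of
   arguments. *)
Section Cumulants.

Variables (A : nzRingType) (C : comNzRingType).
Variables (phi : A -> C) (phi2 : A -> A -> C).
Variables (kappa : seq A -> C) (kappa2 : seq A -> seq A -> C).

Definition kappa_cycle n (a : 'I_n -> A) (s : 'S_n) (c : {set 'I_n}) : C :=
  kappa [seq a i | i <- cycle_seq s c].

Definition kappa_perm n (a : 'I_n -> A) (s : 'S_n) : C :=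
  \prod_(c in porbits s) kappa_cycle a s c.

(* Blocks of elements of PS_NC p q contain one or two cycles; the value in the
   other cases is irrelevant. *)
Definition kappa_block p q (a : 'I_(p + q) -> A) (s : 'S_(p + q))
    (B : {set 'I_(p + q)}) : C :=
  match enum (cycles_in s B) with
  | [:: c] => kappa_cycle a s c
  | [:: c; d] =>
      if c \subset lpart p q
      then kappa2 [seq a i | i <- cycle_seq s c] [seq a i | i <- cycle_seq s d]
      else kappa2 [seq a i | i <- cycle_seq s d] [seq a i | i <- cycle_seq s c]
  | _ => 0
  end.

Definition kappa_pperm p q (a : 'I_(p + q) -> A)
    (x : {set {set 'I_(p + q)}} * 'S_(p + q)) : C :=
  \prod_(B in x.1) kappa_block a x.2 B.

(* The moment-cumulant relations.  They are unitriangular, hence determine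
   kappa on nonempty lists and kappa2 on pairs of nonempty lists (so that
   multilinearity follows from that of phi and phi2, and invariance of kappa
   under rotation of its arguments from that of phi). *)
Definition free_cumulants : Prop :=
  forall (n : nat) (a : 'I_n -> A), (0 < n)%N ->
    phi (\prod_(i < n) a i) = \sum_(s in NC n) kappa_perm a s.

Definition second_order_cumulants : Prop :=
  forall (p q : nat) (a : 'I_(p + q) -> A), (0 < p)%N -> (0 < q)%N ->
    phi2 (\prod_(i < p) a (lshift q i)) (\prod_(j < q) a (rshift p j)) =
    \sum_(x in PS_NC p q) kappa_pperm a x.

End Cumulants.

Section SemiCircular.

Variable C : fieldType.

Definition sc_moment (n : nat) : C :=
  if odd n then 0 else ('C(n, n./2))%:R / (n./2.+1)%:R.

Definition half_bin (m k : nat) : nat :=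
  if (k <= m)%N && ~~ odd (m - k) then 'C(m, (m - k)./2) else 0%N.

(* The terms with k > m vanish. *)
Definition sc_moment2 (m n : nat) : C :=
  if [|| m == 0, n == 0 | odd (m + n)]%N then 0
  else (\sum_(1 <= k < m.+1) k * half_bin m k * half_bin n k)%N%:R.

Definition sc_phi (f : {poly C}) : C := \sum_(i < size f) f`_i * sc_moment i.

Definition sc_phi2 (f g : {poly C}) : C :=
  \sum_(i < size f) \sum_(j < size g) f`_i * g`_j * sc_moment2 i j.

End SemiCircular.

(* Formal power series in z, w: f m n is the coefficient of z^m w^n, and
   equality of series is =2. *)
Section PowerSeries.

Variable C : fieldType.

Definition fps2 := nat -> nat -> C.
Implicit Types f g h : fps2.

Definition fps2_one : fps2 := fun m n => ((m == 0) && (n == 0))%N%:R.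
Definition fps2_z : fps2 := fun m n => ((m == 1) && (n == 0))%N%:R.
Definition fps2_w : fps2 := fun m n => ((m == 0) && (n == 1))%N%:R.
Definition fps2_sub f g : fps2 := fun m n => f m n - g m n.
Definition fps2_mul f g : fps2 := fun m n =>
  \sum_(i < m.+1) \sum_(j < n.+1) f i j * g (m - i)%N (n - j)%N.

Fixpoint fps2_div_rec (N : nat) f g (m n : nat) : C :=
  if N isn't N'.+1 then 0 else
  (g 0%N 0%N)^-1 *
    (f m n - \sum_(i < m.+1) \sum_(j < n.+1 | (0 < i + j)%N)
               g i j * fps2_div_rec N' f g (m - i)%N (n - j)%N).

(* Long division f / g, by recursion on the total degree, for series g with
   nonzero constant term (see fps2_divK and fps2_div_uniq). *)
Definition fps2_div f g : fps2 := fun m n => fps2_div_rec (m + n).+1 f g m n.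

Lemma fps2_div_rec_stable f g N m n : (m + n < N)%N ->
  fps2_div_rec N f g m n = fps2_div f g m n.
Proof.
rewrite /fps2_div; suff H M N' : (m + n < M)%N -> (m + n < N')%N ->
  fps2_div_rec M f g m n = fps2_div_rec N' f g m n by move=> ?; apply: H.
elim: M N' m n => [|M IH] [|N'] m n //= hM hN; congr (_ * (_ - _)).
apply: eq_bigr => i _; apply: eq_bigr => j ij; congr (_ * _).
have lei : (i <= m)%N by rewrite -ltnS.
have lej : (j <= n)%N by rewrite -ltnS.
have lt : (m - i + (n - j) < m + n)%N by lia.
by apply: IH; apply: leq_trans lt _.
Qed.

Lemma fps2_mulE f g m n : fps2_mul g f m n = g 0%N 0%N * f m n +
  \sum_(i < m.+1) \sum_(j < n.+1 | (0 < i + j)%N)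
     g i j * f (m - i)%N (n - j)%N.
Proof.
rewrite /fps2_mul [LHS]pair_big /= (bigD1 (ord0, ord0)) //= !subn0.
congr (_ + _); rewrite pair_big_dep /=; apply: eq_bigl => -[i j] /=.
by rewrite xpair_eqE -!val_eqE /= addn_gt0 !lt0n negb_and.
Qed.

Lemma fps2_divE f g m n : fps2_div f g m n = (g 0%N 0%N)^-1 *
    (f m n - \sum_(i < m.+1) \sum_(j < n.+1 | (0 < i + j)%N)
               g i j * fps2_div f g (m - i)%N (n - j)%N).
Proof.
rewrite {1}/fps2_div [LHS]/=; congr (_ * (_ - _)).
apply: eq_bigr => i _; apply: eq_bigr => j ij; congr (_ * _).
have lei : (i <= m)%N by rewrite -ltnS.
have lej : (j <= n)%N by rewrite -ltnS.
by apply: fps2_div_rec_stable; lia.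
Qed.

Lemma fps2_divK f g : g 0%N 0%N != 0 -> fps2_mul g (fps2_div f g) =2 f.
Proof. by move=> g0 m n; rewrite fps2_mulE {1}fps2_divE mulVKf // subrK. Qed.

Lemma fps2_div_uniq f g h :
  g 0%N 0%N != 0 -> fps2_mul g h =2 f -> h =2 fps2_div f g.
Proof.
move=> g0 ghf m n; have [N] := ubnP (m + n)%N.
elim: N m n => // N IH m n /ltnSE leN.
rewrite fps2_divE -ghf fps2_mulE.
under [X in _ - X]eq_bigr => i _.
  under eq_bigr => j ij.
    rewrite -IH; first over.
    apply: leq_trans leN; have lei : (i <= m)%N by rewrite -ltnS.
    have lej : (j <= n)%N by rewrite -ltnS.
    by lia.
  over.
by rewrite addrK mulKf.
Qed.

End PowerSeries.

Arguments fps2_one {C}.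
Arguments fps2_z {C}.
Arguments fps2_w {C}.

(* Main.v *)
Require Import Defs.
From mathcomp Require Import all_boot all_order all_fingroup all_algebra.
From mathcomp Require Import complex reals.
From mathcomp Require Import zify ring.

(* Both moments are explicit: phi(a^n) is the Catalan number Cat(n), so that
   |NC(n)| = Cat(n) forces kappa_n(a, ..., a) = 1, and phi_2(a^p, a^q) is twice
   A(p,q) = sum_j j binom(2p,p+j) binom(2q,q+j).  The point is |S_NC(p,q)| = A(p,q).
   If s moves e, then multiplying both s and gamma by the transposition
   (e s(e)) fixes e under s and keeps gamma s^-1; in gamma it cuts the cycle of e
   when s(e) lies on it, and merges two cycles otherwise.  Removing the fixed
   point e then gives, for cycles of sizes p+1 and q,
     A(p+1,q) = 2 sum_i Cat(p-i) A(i,q) + q Cat(p+q),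
   the Catalan recursion for one cycle, and the number of s in NC(n) whose cycle
   through e has a given size.
   Hence the sum over PS_NC(p,q)' equals A(p,q) too.  Since the blocks of size m
   number N(p,m) = binom(2p-m-1,p-m) and sum_m N(p,m) binom(m,k) = binom(2p,p+k),
   the unitriangular system
     sum_(m,l) N(p,m) N(q,l) kappa_(m,l) = A(p,q)
   is solved by kappa_(m,l) = sum_k k binom(m,k) binom(l,k) = m binom(m+l-1,m). *)

(** Removing a point cuts a cycle in two, so no induction stays with one or two cycles. Every count
    is therefore stated for [cycs ls], the product of the cycles in a list, over any finite type:
    pieces join the list, removed points remain as fixed points without relabelling, and each cycle
    not involved contributes a Catalan factor. In the recursion for A, once s(e) cuts the first
    cycle, either piece may be the one still joined to the second cycle; together with the case s(e)
    = e this gives the factor 2. Each of the q choices of s(e) on the second cycle merges both into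
    one cycle of size p + q, whence q Cat(p+q). The numbers A satisfy this recursion because
    Pascal's rule writes binom(2p+2,p+1+j) as twice binom(2p+1,p+1+j), a Catalan convolution, plus a
    count of nonnegative paths, and products of path counts sum to a Catalan number. NC(n) is
    defined by crossings and order, not by genus. These conditions are shown to obey the same
    recursion when the least point is removed, which identifies NC(n) with [defect 0 (gamma n)]. *)

Set Implicit Arguments.
Unset Strict Implicit.
Unset Printing Implicit Defensive.

Import GRing.Theory Num.Theory.

(** * Permutations at bounded distance from a geodesic *)

Section Defect.
Local Open Scope group_scope.
Variable T : finType.
Implicit Types (s g : {perm T}) (e f x y : T) (l : seq T) (ls : seq (seq T)).

Lemma card_porbits_mulr_tperm s x y :
  #|porbits (s * tperm x y)| + (x \notin porbit s y).*2
    = #|porbits s| + (x != y) :> nat.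
Proof.
rewrite -[in LHS]porbitsV invMg tpermV -[in RHS]porbitsV -(porbitV s).
exact: porbits_mul_tperm.
Qed.

(* k = 0 says that s lies on a geodesic from 1 to g in the Cayley graph of the
   transpositions (genus 0 within each cycle of g); k = 1 leaves room for one
   handle or for merging two cycles of g. *)
Definition defect (k : nat) g : {set {perm T}} :=
  [set s | (#|porbits s| + #|porbits (g * s^-1)| + k.*2 == #|T| + #|porbits g|)%N].

Lemma mulg_tperm_fix s e : (s * tperm e (s e)) e = e.
Proof. by rewrite permM tpermR. Qed.

Lemma perm_in_porbit s x : s x \in porbit s x.
Proof. by rewrite -{1}(expg1 s) mem_porbit. Qed.

Lemma card_porbits_unhook s e : s e != e ->
  #|porbits (s * tperm e (s e))| = #|porbits s|.+1.
Proof.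
move=> se; have := card_porbits_mulr_tperm s e (s e).
by rewrite eq_sym se porbit_sym perm_in_porbit addn0 addn1.
Qed.

Lemma mulg_tpermK g s x y : (g * tperm x y) * (s * tperm x y)^-1 = g * s^-1.
Proof. by rewrite invMg tpermV mulgA -(mulgA g) tperm2 mulg1. Qed.

Lemma card_porbits1 : #|porbits (1 : {perm T})| = #|T|.
Proof.
rewrite card_imset // => x y; move/eqP; rewrite eq_porbit_mem.
by rewrite porbit.unlock cycle1 imset_set1 /aperm perm1 inE => /eqP.
Qed.

(** The genus is nonnegative. Induction on the number of moved points: the hook at a moved e adds a
    cycle to s, keeps [g * s^-1], and adds at most one cycle to g. *)
Lemma card_porbits_le g s :
  (#|porbits s| + #|porbits (g * s^-1)| <= #|T| + #|porbits g|)%N.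
Proof.
have [n] := ubnP #|[set x | s x != x]|; elim: n s g => // n IH s g /ltnSE le_n.
have [s1|[e]] := set_0Vmem [set x | s x != x].
  have -> : s = 1.
    apply/permP=> x; apply/eqP; rewrite perm1; apply: contraT => sx.
    by move/setP: s1 => /(_ x); rewrite !inE sx.
  by rewrite invg1 mulg1 card_porbits1.
rewrite inE => se; set t := tperm e (s e).
have lt : (#|[set x | (s * t)%g x != x]| < n)%N.
  apply: leq_trans le_n; apply/proper_card/properP; split; last first.
    by exists e; rewrite !inE // mulg_tperm_fix eqxx.
  apply/subsetP => x; rewrite !inE permM; apply: contra => /eqP sx.
  rewrite sx; rewrite /t; case: tpermP => // xe; first by rewrite -xe sx xe.
  by move: sx; rewrite xe => /perm_inj sx; rewrite sx eqxx in se.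
have := IH _ (g * t) lt; rewrite mulg_tpermK card_porbits_unhook //.
by have := card_porbits_mulr_tperm g e (s e); rewrite -/t; lia.
Qed.

(** Merging cycles of g lowers their number by one where cutting raises it by one; this difference
    of two is one unit of k. *)
Lemma defect_hook k g s e : s e != e ->
  (s \in defect (k + (s e \notin porbit g e)) g)
    = (s * tperm e (s e) \in defect k (g * tperm e (s e))).
Proof.
move=> se; rewrite !inE mulg_tpermK card_porbits_unhook //.
have := card_porbits_mulr_tperm g e (s e).
by rewrite eq_sym se porbit_sym; lia.
Qed.

(** As s fixes e, conjugation by [s^-1] turns the transposition that detaches e from g into the one
    that detaches e from [g * s^-1], so both cycle counts grow together. *)
Lemma defect_unhook k g s e : s e = e ->
  (s \in defect k g) = (s \in defect k (g * tperm e (g e))).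
Proof.
move=> se; have [ge|ge] := eqVneq (g e) e; first by rewrite ge tperm1 mulg1.
have se' : s^-1 e = e by rewrite -{1}se permK.
have gs : g * tperm e (g e) * s^-1 = (g * s^-1) * tperm e ((g * s^-1) e).
  rewrite permM -{3}se' -tpermJ conjgE invgK !mulgA.
  by rewrite mulgKV.
rewrite !inE gs !card_porbits_unhook //; first lia.
by rewrite permM -{2}se' (inj_eq perm_inj).
Qed.

(** Otherwise the hook at x would merge two cycles of g while adding one to s, against
    [card_porbits_le]. *)
Lemma defect0_porbit g s x : s \in defect 0 g -> s x \in porbit g x.
Proof.
move=> s0; have [->|sx] := eqVneq (s x) x; first exact: porbit_id.
apply: contraTT s0 => sxN; rewrite inE.
have := card_porbits_le (g * tperm x (s x)) (s * tperm x (s x)).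
rewrite mulg_tpermK card_porbits_unhook //.
have := card_porbits_mulr_tperm g x (s x).
by rewrite eq_sym sx porbit_sym sxN; lia.
Qed.

Lemma porbit_mulr_tperm g e f x : e \notin porbit g x -> f \notin porbit g x ->
  porbit (g * tperm e f) x = porbit g x.
Proof.
move=> ex fx; apply/porbit_setP => y.
have E i : iter i (g * tperm e f) x = iter i g x.
  elim: i => //= i ->; rewrite permM -iterS -permX tpermD //.
    by apply: contraNneq ex => ->; apply: mem_porbit.
  by apply: contraNneq fx => ->; apply: mem_porbit.
by apply/porbitP/porbitP => -[i ->]; exists i; rewrite !permX E.
Qed.

(** Defect 1 pays for one merge. Hooking a spends it and leaves defect 0, so [defect0_porbit],
    applied to b in the merged permutation, puts b and [s b] on the two cycles already merged. *)
Lemma defect1_merge g s a b : s \in defect 1 g ->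
  s a \notin porbit g a -> s b \notin porbit g b ->
  ((b \in porbit g a) || (b \in porbit g (s a))) /\
  ((s b \in porbit g a) || (s b \in porbit g (s a))).
Proof.
move=> s1 sa sb; have nea : s a != a.
  by apply: contraNneq sa => ->; apply: porbit_id.
have [->|neb] := eqVneq b a.
  by rewrite !porbit_id orbT.
have nef : s b != s a by rewrite (inj_eq perm_inj).
have s0 : s * tperm a (s a) \in defect 0 (g * tperm a (s a)).
  by rewrite -defect_hook // sa add0n.
have := defect0_porbit b s0; rewrite permM => in_b; split; apply/norP => -[].
  move=> ba bf; move: in_b; rewrite porbit_mulr_tperm; first last.
  - by rewrite porbit_sym.
  - by rewrite porbit_sym.
  case: tpermP => [_|/eqP|_ _].
  - by rewrite porbit_sym (negPf bf).
  - by rewrite (negPf nef).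
  - by rewrite (negPf sb).
move=> ba bf; move: in_b; rewrite tpermD; first last.
- by rewrite eq_sym.
- by apply: contraNneq ba => <-; apply: porbit_id.
by rewrite porbit_sym porbit_mulr_tperm 1?porbit_sym ?(negPf sb).
Qed.

End Defect.

(** * Permutations given by lists of cycles: detaching, cutting and merging *)

Section ListCycles.
Local Open Scope group_scope.
Variable T : finType.
Implicit Types (s g : {perm T}) (e f x y : T) (l : seq T) (ls : seq (seq T)).

(** A product of transpositions, so that detaching the head e cancels the last factor. *)
Fixpoint cyc l : {perm T} :=
  if l is e :: l' then if l' is x :: _ then cyc l' * tperm e x else 1 else 1.

Definition cycs ls : {perm T} := \prod_(l <- ls) cyc l.

Lemma cyc_cons2 e x l : cyc [:: e, x & l] = cyc (x :: l) * tperm e x.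
Proof. by []. Qed.

Lemma cyc_out l x : x \notin l -> cyc l x = x.
Proof.
elim: l => [|e [|y l] IH]; rewrite ?perm1 // => xN.
rewrite cyc_cons2 permM IH; last by apply: contra xN; rewrite !inE => ->; rewrite orbT.
by rewrite tpermD //; apply: contraNneq xN => <-; rewrite !inE eqxx ?orbT.
Qed.

Lemma path_mulr_tperm g e f x l : e \notin l -> f \notin l ->
  path (frel g) x l -> path (frel (g * tperm e f)) x l.
Proof.
elim: l x => //= y l IH x; rewrite !inE !negb_or => /andP[ey el] /andP[fy fl].
case/andP=> /eqP gx /IH ->; rewrite // andbT permM gx tpermD //.
Qed.

Lemma fcycle_hook g e x l : g e = e -> uniq [:: e, x & l] ->
  fcycle g (x :: l) -> fcycle (g * tperm e x) [:: e, x & l].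
Proof.
move=> ge /=; rewrite inE negb_or => /and3P[/andP[_ el] xl _].
rewrite permM ge tpermL eqxx /= !rcons_path /= permM => /andP[P /eqP ->].
by rewrite tpermR eqxx andbT; apply: path_mulr_tperm P.
Qed.

Lemma cyc_fcycle l : uniq l -> fcycle (cyc l) l.
Proof.
elim: l => [|e [|x l] IH] U //; first by rewrite /= perm1 eqxx.
rewrite cyc_cons2; apply: fcycle_hook => //.
  by apply: cyc_out; case/andP: U.
by apply: IH; case/andP: U.
Qed.

Lemma fcycle_eq_in g h l : {in l, g =1 h} -> fcycle g l = fcycle h l.
Proof.
move=> gh; apply: (@eq_in_cycle _ (mem l)); last exact/allP.
by move=> x y xl _ /=; rewrite gh.
Qed.

Lemma fcycle_fix g x l : fcycle g l -> x \in l -> g x = next l x.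
Proof. by move=> /next_cycle H /H /eqP. Qed.

Lemma cycs_cons l ls : cycs (l :: ls) = cyc l * cycs ls.
Proof. exact: big_cons. Qed.

Lemma cycs_out ls x : x \notin flatten ls -> cycs ls x = x.
Proof.
elim: ls => [|l ls IH] /=; first by rewrite /cycs big_nil perm1.
rewrite mem_cat negb_or cycs_cons permM => /andP[xl xls].
by rewrite cyc_out // IH.
Qed.

Lemma cyc_mem l x : uniq l -> x \in l -> cyc l x \in l.
Proof. by move=> U xl; rewrite (fcycle_fix (cyc_fcycle U)) // mem_next. Qed.

Lemma cycs_fcycle ls l : uniq (flatten ls) -> l \in ls -> fcycle (cycs ls) l.
Proof.
elim: ls => // l' ls IH /=; rewrite cat_uniq => /and3P[U' /hasPn D U].
rewrite inE => /predU1P[->|lls].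
  suff -> : fcycle (cycs (l' :: ls)) l' = fcycle (cyc l') l' by apply: cyc_fcycle.
  apply: fcycle_eq_in => x xl.
  rewrite cycs_cons permM cycs_out //.
  by apply: contraL (cyc_mem U' xl) => /D.
suff -> : fcycle (cycs (l' :: ls)) l = fcycle (cycs ls) l by apply: IH.
apply: fcycle_eq_in => x xl.
rewrite cycs_cons permM (cyc_out (l := l')) //.
by apply: D; apply/flattenP; exists l.
Qed.

Lemma eq_cycs g ls : uniq (flatten ls) -> {in ls, forall l, fcycle g l} ->
  (forall x, x \notin flatten ls -> g x = x) -> g = cycs ls.
Proof.
move=> U gl gx; apply/permP => x; have [xls|xls] := boolP (x \in flatten ls).
  case/flattenP: xls => l lls xl.
  by rewrite (fcycle_fix (gl l lls) xl) (fcycle_fix (cycs_fcycle U lls) xl).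
by rewrite gx // cycs_out.
Qed.

Lemma porbit_fcycle g l x : fcycle g l -> x \in l -> porbit g x =i l.
Proof.
move=> gl xl y; rewrite -(fconnect_cycle gl xl); apply/porbitP/idP => [[i ->]|].
  by rewrite permX fconnect_iter.
by case/connectP => p /fpathP[n ->] ->; exists n; rewrite permX last_traject.
Qed.

Lemma porbit_cycs ls l x : uniq (flatten ls) -> l \in ls -> x \in l ->
  porbit (cycs ls) x =i l.
Proof. by move=> U lls; apply: porbit_fcycle; apply: cycs_fcycle. Qed.

Lemma cycs_perm ls ls' : uniq (flatten ls) -> perm_eq ls ls' ->
  cycs ls = cycs ls'.
Proof.
move=> U ls_ls'; have F := perm_flatten ls_ls'.
apply: eq_cycs; first by rewrite -(perm_uniq F).
  by move=> l; rewrite -(perm_mem ls_ls'); apply: cycs_fcycle.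
by move=> x; rewrite -(perm_mem F); apply: cycs_out.
Qed.

Lemma tperm_fixC g e x : g e = e -> g x = x -> g * tperm e x = tperm e x * g.
Proof. by move=> ge gx; rewrite (conjgC (tperm e x)) tpermJ ge gx. Qed.

Lemma cyc_split e f l1 l2 : uniq (e :: l1 ++ f :: l2) ->
  cyc (e :: l1 ++ f :: l2) = cyc (e :: l1) * cyc (f :: l2) * tperm e f.
Proof.
elim: l1 e => [|x l1 IH] e U; first by rewrite /= mul1g.
have [xe xf ef] : [/\ x != e, x \notin f :: l2 & e \notin f :: l2].
  move: U => /= /andP[]; rewrite !inE !mem_cat !inE !negb_or.
  move=> /and4P[ex _ ef el2] /andP[/and3P[_ xf xl] _].
  by rewrite eq_sym ex xf xl ef el2.
have [nxf nef] : x != f /\ e != f.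
  by move: xf ef; rewrite !inE !negb_or => /andP[-> _] /andP[-> _].
have/andP[eN U'] := U.
rewrite !cat_cons !cyc_cons2 IH // -!mulgA; congr (_ * _).
rewrite [RHS]mulgA -(tperm_fixC (g := cyc (f :: l2))) ?cyc_out // -[RHS]mulgA.
congr (_ * _).
by rewrite conjgC tpermJ tpermR tpermD // eq_sym.
Qed.

Lemma cyc_rot l1 l2 : uniq (l1 ++ l2) -> cyc (l1 ++ l2) = cyc (l2 ++ l1).
Proof.
move=> U; have U' : uniq (l2 ++ l1) by rewrite uniq_catC.
have E : cycs [:: l2 ++ l1] = cyc (l2 ++ l1) by rewrite /cycs big_seq1.
rewrite -E; apply: eq_cycs; rewrite /= ?cats0 //.
  by move=> l; rewrite inE => /eqP->; rewrite -(rot_size_cat l1 l2) rot_cycle cyc_fcycle.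
by move=> x xN; apply: cyc_out; rewrite mem_cat orbC -mem_cat.
Qed.

Lemma cycs_unhook e l ls : uniq (flatten ((e :: l) :: ls)) ->
  let g := cycs ((e :: l) :: ls) in g * tperm e (g e) = cycs (l :: ls).
Proof.
move=> U g; have eN : e \notin l ++ flatten ls by case/andP: U.
have [el els] : e \notin l /\ e \notin flatten ls.
  by apply/andP; rewrite -negb_or -mem_cat.
case: l => [|x l] in U g eN el *.
  by rewrite /g !cycs_cons permM perm1 cycs_out // tperm1 mulg1.
have xls : x \notin flatten ls.
  by move: U => /= /andP[_ /andP[]]; rewrite mem_cat negb_or => /andP[_ ->].
have -> : g e = x by rewrite /g cycs_cons cyc_cons2 !permM cyc_out // tpermL cycs_out.
rewrite /g !cycs_cons -mulgA tperm_fixC ?cycs_out //.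
by rewrite cyc_cons2 -!mulgA (mulgA (tperm e x)) tperm2 mul1g.
Qed.

Lemma cycs_split e f l1 l2 ls :
    uniq (flatten ((e :: l1 ++ f :: l2) :: ls)) ->
  cycs ((e :: l1 ++ f :: l2) :: ls) * tperm e f
    = cycs [:: e :: l1, f :: l2 & ls].
Proof.
rewrite [flatten _]/= -cat_cons cat_uniq => /and3P[U /hasPn D _].
have els : e \notin flatten ls by apply: contraL (mem_head e (l1 ++ f :: l2)) => /D.
have fls : f \notin flatten ls.
  by apply/negP => /D /=; rewrite inE mem_cat inE eqxx !orbT.
rewrite !cycs_cons -mulgA tperm_fixC ?cycs_out // cyc_split // -!mulgA.
by rewrite (mulgA (tperm e f)) tperm2 mul1g.
Qed.

(** This is [cycs_split] read backwards, once the second cycle is rotated to start at f. *)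
Lemma cycs_merge e f l1 l2 l3 ls :
    uniq (flatten [:: e :: l1, l2 ++ f :: l3 & ls]) ->
  cycs [:: e :: l1, l2 ++ f :: l3 & ls] * tperm e f
    = cycs ((e :: l1 ++ f :: l3 ++ l2) :: ls).
Proof.
move=> U.
have U' : uniq (flatten ((e :: l1 ++ f :: l3 ++ l2) :: ls)).
  suff P : perm_eq (flatten [:: e :: l1, l2 ++ f :: l3 & ls])
                   (flatten ((e :: l1 ++ f :: l3 ++ l2) :: ls)).
    by rewrite -(perm_uniq P).
  rewrite /= perm_cons -[X in perm_eq _ X]catA perm_cat2l perm_cat2r.
  by rewrite -cat_cons perm_catC.
rewrite -[RHS](mulgK (tperm e f)) cycs_split // tpermV !cycs_cons.
rewrite -cat_cons (cyc_rot (l1 := f :: l3)) // uniq_catC.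
have U1 : uniq ((e :: l1) ++ (l2 ++ f :: l3) ++ flatten ls) by [].
move: U1; rewrite (cat_uniq (e :: l1)) => /and3P[_ _ U2].
by move: U2; rewrite (cat_uniq (l2 ++ f :: l3)) => /and3P[].
Qed.

End ListCycles.

(** * Ballot numbers and binomial identities *)

(* The coefficient of z^n in the m-th power of the generating series C(z) of
   the Catalan numbers; the recursion is C^(m+1) = C^m + z C^(m+2). *)
Fixpoint ballot (n : nat) : nat -> nat :=
  if n is n'.+1 then
    fix b m := if m is m'.+1 then b m' + ballot n' m'.+2 else 0
  else fun=> 1.

Notation catalan n := (ballot n 1).

Lemma ballotn0 n : ballot n.+1 0 = 0. Proof. by []. Qed.
Lemma ballotS n m : ballot n.+1 m.+1 = ballot n.+1 m + ballot n m.+2.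
Proof. by []. Qed.

(** With F_m the series of [f n m] in n, the hypotheses read F_(m+1) = F_m + z F_(m+2) and the
    conclusion C(z) F_m = F_(m+1). The recursion propagates it in m, so only m = 0 needs its own
    argument. It serves for C^m and for C^m / sqrt(1-4z), whose coefficients are binom(2n+m,n). *)
Lemma catalan_conv_ext (f : nat -> nat -> nat) :
    (forall m, f 0 m = 1) ->
    (forall n m, f n.+1 m.+1 = f n.+1 m + f n m.+2) ->
    (forall n, (forall m, \sum_(i < n.+1) catalan i * f (n - i) m = f n m.+1) ->
       \sum_(i < n.+2) catalan i * f (n.+1 - i) 0 = f n.+1 1) ->
  forall n m, \sum_(i < n.+1) catalan i * f (n - i) m = f n m.+1.
Proof.
move=> f0 fS base; elim=> [|n IHn] m; first by rewrite big_ord1 !f0.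
elim: m => [|m IHm]; first exact: base.
rewrite [RHS]fS -IHm -IHn [LHS]big_ord_recr [X in _ = X + _]big_ord_recr /=.
rewrite subnn !f0 addnAC -big_split /=; congr (_ + _).
apply: eq_bigr => i _; rewrite -mulnDr subSn ?fS //.
by rewrite -ltnS ltn_ord.
Qed.

Lemma ballot_conv n m : \sum_(i < n.+1) catalan i * ballot (n - i) m = ballot n m.+1.
Proof.
move: n m; apply: catalan_conv_ext => // n _.
rewrite big_ord_recr /= subnn muln1 big1 // => i _.
by rewrite subSn ?muln0 // -ltnS ltn_ord.
Qed.

Lemma catalan_conv n : \sum_(i < n.+1) catalan i * catalan (n - i) = catalan n.+1.
Proof. by rewrite ballot_conv ballotS ballotn0. Qed.

(** The reflection principle, written additively because subtraction in [nat] truncates. *)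
Lemma ballot_bin n r : ballot n.+1 r + 'C(n.*2 + r.+1, n) = 'C(n.*2 + r.+1, n.+1).
Proof.
elim: n r => [|n IHn] r.
  rewrite bin0 bin1 !add0n addn1; congr _.+1.
  by elim: r => //= r ->; rewrite addn1.
elim: r => [|r IHr].
  rewrite add0n addn1 -(bin_sub (m := n.+1)); last lia.
  by congr 'C(_, _); lia.
have := IHn r.+2; rewrite (ballotS n.+1).
have -> : n.+1.*2 + r.+2 = (n.*2 + r.+3).+1 by lia.
have E : n.+1.*2 + r.+1 = n.*2 + r.+3 by lia.
rewrite E in IHr; rewrite !binS; lia.
Qed.

(** The cycle-lemma formula with denominators cleared. At m = 0 it gives the Catalan moments; for
    other m it turns counts through a point into counts of blocks. *)
Lemma ballot_mul n m : (n + m.+1) * ballot n m.+1 = m.+1 * 'C(n.*2 + m, n).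
Proof.
case: n => [|n]; first by rewrite bin0.
have H := ballot_bin n m.+1; have := mul_bin_left (n.*2 + m.+2) n.
have E1 : n.*2 + m.+2 = n.+1.*2 + m by lia.
have -> : n.*2 + m.+2 - n = n + m.+2 by lia.
rewrite E1 in H *; move: (congr1 (muln (n + m.+2)) H).
by rewrite mulnDr => H1 H2; rewrite -H2 in H1; move: H1; lia.
Qed.

(** Classify the subsets of size a+b+1 of n+1 points by the position m of the element with exactly b
    chosen points below it. *)
Lemma bin_conv n a b : \sum_(m < n.+1) 'C(n - m, a) * 'C(m, b) = 'C(n.+1, a + b.+1).
Proof.
elim: n a => [|n IHn] a.
  by rewrite big_ord1 subnn addnS binS !bin0n; case: a; case: b.
case: a => [|a].
  have H := IHn 0; rewrite !add0n in H *.
  rewrite big_ord_recr /= bin0 mul1n [RHS]binS -H; congr (_ + _).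
  by apply: eq_bigr => i _; rewrite !bin0.
rewrite big_ord_recr /= subnn mul0n addn0 addSn [RHS]binS -addSn -!IHn -big_split /=.
apply: eq_bigr => i _; rewrite subSn ?binS ?mulnDl //.
by rewrite -ltnS ltn_ord.
Qed.

(** The series of binom(2i,i+j) in i is z^j C(z)^(2j) / sqrt(1-4z); one more factor C(z) gives the
    coefficient binom(2p+1,p-j). *)
Lemma catalan_bin_conv p j :
  \sum_(i < p.+1) catalan (p - i) * 'C(i.*2, i + j) = 'C(p.*2.+1, p.+1 + j).
Proof.
have conv n m : \sum_(i < n.+1) catalan i * 'C((n - i).*2 + m, n - i)
    = 'C(n.*2 + m.+1, n).
  move: n m; apply: (@catalan_conv_ext (fun n m => 'C(n.*2 + m, n))) => //.
  - by move=> m; rewrite bin0.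
  - by move=> n m; rewrite addnS binS doubleS !addSn !addnS.
  move=> n IH; rewrite big_ord_recr /= subnn bin0 muln1.
  (* A central binomial coefficient is twice its neighbour in the preceding row; this reduces m = 0
     at order n+1 to m = 1 at order n. *)
  have E (i : 'I_n.+1) : catalan i * 'C((n.+1 - i).*2 + 0, n.+1 - i)
     = 2 * (catalan i * 'C((n - i).*2 + 1, n - i)).
    have le_i : i <= n by rewrite -ltnS.
    rewrite mulnCA subSn // addn0 doubleS binS addn1; congr (_ * _).
    rewrite -[X in X + _](bin_sub (m := (n - i).+1)); last lia.
    by rewrite mulSn mul1n; congr ('C(_, _) + _); lia.
  rewrite (eq_bigr _ (fun i _ => E i)) -big_distrr /= IH.
  have -> : n.+1.*2 + 1 = (n.*2 + 2).+1 by lia.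
  by rewrite binS -(ballot_bin n 1) ballotS ballotn0; lia.
have [le_jp|lt_pj] := leqP j p; last first.
  rewrite bin_small ?big1 //; last by lia.
  by move=> i _; rewrite bin_small ?muln0 //; have := ltn_ord i; lia.
rewrite (reindex_inj rev_ord_inj) /=.
have -> : 'C(p.*2.+1, p.+1 + j) = 'C((p - j).*2 + j.*2.+1, p - j).
  by rewrite -[LHS]bin_sub; [congr 'C(_, _)|]; lia.
rewrite -conv (big_ord_widen p.+1 (fun i => catalan i * 'C((p - j - i).*2 + j.*2, p - j - i))); last by lia.
rewrite [LHS](bigID (fun i : 'I_p.+1 => i < (p - j).+1)) /= [X in _ + X]big1 ?addn0.
  apply: eq_bigr => i; rewrite ltnS => le_i.
  have := ltn_ord i; rewrite ltnS => lip.
  rewrite subSS subKn // -bin_sub; last lia.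
  by congr (_ * 'C(_, _)); lia.
move=> i; have := ltn_ord i; rewrite -leqNgt => H1 H2.
by rewrite bin_small ?muln0 //; lia.
Qed.

(* The number of paths from 0 to h with n steps +1 or -1 that stay nonnegative. *)
Fixpoint walk (n h : nat) : nat :=
  if n is n'.+1 then (if h is h'.+1 then walk n' h' else 0) + walk n' h.+1
  else h == 0.

Lemma walk_small n h : n < h -> walk n h = 0.
Proof. by elim: n h => [|n IH] [|h] //= lt_nh; rewrite !IH //; lia. Qed.

Lemma walk_odd n h : odd (n + h) -> walk n h = 0.
Proof.
by elim: n h => [|n IH] [|h] //= H; rewrite !IH //; lia.
Qed.

(** Cutting such a path after its last visits to the heights 0, ..., m-1 leaves m+1 excursions, each
    with series C(z). *)
Lemma walk_ballot n m : walk (n.*2 + m) m = ballot n m.+1.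
Proof.
elim: n m => [|n IHn] m.
  by rewrite add0n; elim: m => //= m ->; rewrite walk_small //; lia.
elim: m => [|m IHm]; first by rewrite -[RHS]/(ballot n 2) -IHn doubleS addn0 /= add0n addn1.
rewrite -[RHS]/(ballot n.+1 m.+1 + ballot n m.+3) -IHm -IHn.
rewrite addnS -[LHS]/(walk (n.+1.*2 + m) m + walk (n.+1.*2 + m) m.+2).
by congr (_ + walk _ _); lia.
Qed.

(** The one-step operator on heights is symmetric, so a step can pass from one path to the other; H
    exceeds every height that is reached. *)
Lemma walk_shift H a c : a.+1 < H -> c.+1 < H ->
  \sum_(h < H) walk a.+1 h * walk c h = \sum_(h < H) walk a h * walk c.+1 h.
Proof.
case: H => // H aH cH.
have E a' c' : c'.+1 < H.+1 -> \sum_(h < H.+1) walk a'.+1 h * walk c' h =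
    \sum_(h < H) walk a' h * walk c' h.+1 + \sum_(h < H) walk a' h.+1 * walk c' h.
  move=> cH'; rewrite /= (eq_bigr _ (fun h _ => mulnDl _ _ _)) big_split /=.
  rewrite big_ord_recl /= mul0n add0n; congr (_ + _).
  by rewrite big_ord_recr /= (walk_small (n := c')) ?muln0 ?addn0.
rewrite E // [RHS](_ : _ = \sum_(h < H.+1) walk c.+1 h * walk a h); last first.
  by apply: eq_bigr => h _; rewrite mulnC.
rewrite E //.
by rewrite addnC; congr (_ + _); apply: eq_bigr => h _; rewrite mulnC.
Qed.

(** Cut a closed path at time a and reverse its second part. *)
Lemma walk_conv H a c : a + c < H ->
  \sum_(h < H) walk a h * walk c h = walk (a + c) 0.
Proof.
elim: a c => [|a IH] c ltH; last first.
  by rewrite walk_shift ?IH; [congr walk| | |]; lia.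
case: H ltH => // H _; rewrite big_ord_recl /= mul1n add0n big1 ?addn0 //.
Qed.

Arguments ballot : simpl never.
Arguments walk : simpl never.

(** After an odd number of steps the height is odd, so the even terms of [walk_conv] vanish. *)
Lemma walk_conv_odd B p q : (p + q).+1 < B ->
  \sum_(j < B) walk p.*2.+1 j.*2.+1 * walk q.*2.+1 j.*2.+1 = catalan (p + q).+1.
Proof.
move=> ltB; rewrite -walk_ballot addn0.
have -> : (p + q).+1.*2 = p.*2.+1 + q.*2.+1 by lia.
rewrite -(walk_conv (H := B.*2)); last by lia.
elim: (B) => [|b IH]; first by rewrite !big_ord0.
rewrite doubleS !big_ord_recr /= IH (@walk_odd _ b.*2) ?mul0n ?addn0 //; lia.
Qed.

(** Reflection again, at the odd lengths and heights that Pascal's rule produces in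
    [annular_rec]. *)
Lemma walk_bin q j : walk q.*2.+1 j.*2.+1 + 'C(q.*2.+1, q + j.+2) = 'C(q.*2.+1, q + j.+1).
Proof.
elim: q j => [|q IH] j; first by case: j => [|[|j]].
have binSS n k : 'C(n.+2, k.+2) = 'C(n, k.+2) + 'C(n, k.+1).*2 + 'C(n, k).
  by rewrite !binS; lia.
rewrite doubleS; case: j => [|j].
  have S : 'C(q.*2.+1, q) = 'C(q.*2.+1, q.+1).
    by rewrite -[LHS]bin_sub; [congr 'C(_, _)|]; lia.
  have -> : walk q.*2.+3 1 = walk q.*2.+1 1 + (walk q.*2.+1 1 + walk q.*2.+1 3) by [].
  have := IH 0; have := IH 1; rewrite !addSn !addn2 !addn3 addn1 !binSS.
  by rewrite -[0.*2.+1]/1 -[1.*2.+1]/3; lia.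
have -> : walk q.*2.+3 j.+1.*2.+1 = walk q.*2.+1 j.*2.+1 + walk q.*2.+1 j.+1.*2.+1
    + (walk q.*2.+1 j.+1.*2.+1 + walk q.*2.+1 j.+2.*2.+1) by [].
have := IH j; have := IH j.+1; have := IH j.+2.
by rewrite !addSn !addnS !binSS; lia.
Qed.

(** This trades the weight j in A(p,q) for a factor q and a path count. *)
Lemma mul_walk q j : q.+1 * walk q.*2.+1 j.*2.+1 = j.+1 * 'C(q.+1.*2, q.+1 + j.+1).
Proof.
have H := walk_bin q j; rewrite !addnS in H.
have H1 := mul_bin_diag q.*2.+2 (q + j).+1.
have H2 := mul_bin_down q.*2.+2 (q + j).+2.
rewrite doubleS addSn addnS; move: H1 H2; rewrite -H /= mulnDr => H1 H2.
have [le|lt] := leqP (q + j).+2 q.*2.+2; last first.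
  move: H; rewrite !bin_small; lia.
have E : q.*2.+2 - (q + j).+2 = q - j by lia.
rewrite E in H2; rewrite H2 in H1; apply/eqP; rewrite -(eqn_pmul2l (m := 2)) //.
rewrite !mulnA; apply/eqP; move: H1; have -> : 2 * q.+1 = q.*2.+2 by lia.
have -> : (q + j).+2 = 2 * j.+1 + (q - j) by lia.
by rewrite mulnDl => /addIn.
Qed.

Definition annular (p q : nat) : nat :=
  \sum_(j < p.+1) j * 'C(p.*2, p + j) * 'C(q.*2, q + j).

Lemma annularE B p q : p < B ->
  annular p q = \sum_(j < B) j * 'C(p.*2, p + j) * 'C(q.*2, q + j).
Proof.
move=> ltB; rewrite /annular.
rewrite (big_ord_widen B (fun j => j * 'C(p.*2, p + j) * 'C(q.*2, q + j))) //.
rewrite [RHS](bigID (fun i : 'I_B => i < p.+1)) /= [X in _ + X]big1 ?addn0 //.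
by move=> i Hi; rewrite bin_small ?muln0 //; lia.
Qed.

Lemma annular0 q : annular 0 q = 0.
Proof. by rewrite /annular big_ord1. Qed.

(** Pascal's rule and [walk_bin] split the first binomial of each summand. The doubled part is
    [catalan_bin_conv]; in the other, [mul_walk] makes the second binomial a path count as well, and
    [walk_conv_odd] sums the products. *)
Lemma annular_rec p q :
  annular p.+1 q = 2 * (\sum_(i < p.+1) catalan (p - i) * annular i q)
                   + q * catalan (p + q).
Proof.
case: q => [|q].
  rewrite mul0n addn0 [LHS]big1 ?big1 ?muln0 // => i _.
    by rewrite [annular _ _]big1 ?muln0 // => j _; case: (val j) => // k; rewrite muln0.
  by case: (val i) => // k; rewrite muln0.
set B := (p + q).+3.
rewrite (annularE (B := B.+1)); last by rewrite /B; lia.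
rewrite big_ord_recl /= !mul0n add0n.
have E (j : 'I_B) : j.+1 * 'C(p.+1.*2, p.+1 + j.+1) * 'C(q.+1.*2, q.+1 + j.+1)
  = 2 * \sum_(i < p.+1) catalan (p - i) * (j.+1 * 'C(i.*2, i + j.+1) * 'C(q.+1.*2, q.+1 + j.+1))
    + q.+1 * (walk p.*2.+1 j.*2.+1 * walk q.*2.+1 j.*2.+1).
  rewrite mulnCA mul_walk.
  rewrite (eq_bigr (fun i : 'I_p.+1 => catalan (p - i) * 'C(i.*2, i + j.+1) *
     (j.+1 * 'C(q.+1.*2, q.+1 + j.+1)))); last by move=> i _; lia.
  rewrite -big_distrl /= catalan_bin_conv.
  have := walk_bin p j.
  rewrite doubleS !addSn !addnS (binS p.*2.+1) => <-.
  lia.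
rewrite (eq_bigr _ (fun j _ => E j)) big_split /= -!big_distrr /=; congr (_ + _); last first.
  by rewrite walk_conv_odd ?addnS // /B; lia.
congr (2 * _); rewrite exchange_big /=; apply: eq_bigr => i _.
rewrite -big_distrr /= (annularE (B := B.+1)); last by have := ltn_ord i; rewrite /B; lia.
by rewrite [in RHS]big_ord_recl /= !mul0n add0n.
Qed.

(** For m > 0 symmetry gives binom(2p-m-1,p-1), so this is [bin_conv]. The coefficient at m = 0 does
    not fit that form, but there ['C(m, k)] vanishes as k > 0. *)
Lemma block_count_conv p k : 0 < k ->
  \sum_(m < p.+1) 'C(p.*2 - m.+1, p - m) * 'C(m, k) = 'C(p.*2, p + k).
Proof.
case: k => // k _; case: p => [|p]; first by rewrite big_ord1 muln0.
have -> : 'C(p.+1.*2, p.+1 + k.+1) = 'C(p.*2.+2, p + k.+2).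
  by congr 'C(_, _); lia.
rewrite -bin_conv (big_ord_widen p.*2.+2 (fun m => 'C(p.+1.*2 - m.+1, p.+1 - m) * 'C(m, k.+1))); last lia.
rewrite [RHS](bigID (fun i : 'I_p.*2.+2 => i < p.+2)) /= [X in _ = _ + X]big1 ?addn0.
  apply: eq_bigr => m lt_m; case: m lt_m => [[|m] /= ltm] lt_m; first by rewrite bin0n !muln0.
  by congr (_ * _); rewrite -[LHS]bin_sub; [congr 'C(_, _)|]; lia.
by move=> i Hi; rewrite (@bin_small (_ - _)) ?mul0n //; have := ltn_ord i; lia.
Qed.

(** Vandermonde after k binom(m,k) = m binom(m-1,k-1). The right-hand side separates m from l, which
    is how [annular_block_count] uses it. *)
Lemma mul_bin_conv m l B : m <= B ->
  m * 'C(m + l - 1, m) = \sum_(k < B.+1) k * 'C(m, k) * 'C(l, k).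
Proof.
move=> le_mB; have -> : \sum_(k < B.+1) k * 'C(m, k) * 'C(l, k)
    = \sum_(k < m.+1) k * 'C(m, k) * 'C(l, k).
  rewrite [RHS](big_ord_widen B.+1 (fun k => k * 'C(m, k) * 'C(l, k))) //.
  rewrite [LHS](bigID (fun i : 'I_B.+1 => i < m.+1)) /= [X in _ + X]big1 ?addn0 //.
  by move=> i Hi; rewrite (@bin_small m) ?muln0 //; lia.
case: m le_mB => [|m] _; first by rewrite big_ord1 mul0n.
rewrite addSn subn1 /= addnC -binomial.Vandermonde big_distrr /=; apply: eq_bigr => k _.
have := ltn_ord k; case: (val k) => [|j] lt_j.
  by rewrite subn0 (@bin_small m) ?muln0 //.
rewrite subSS bin_sub; last by lia.
rewrite -mul_bin_diag -mulnA; congr (_ * _); exact: mulnC.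
Qed.

(** * Counting by removing a point *)

Section Counting.
Local Open Scope group_scope.
Variable T : finType.
Implicit Types (s g : {perm T}) (e f x y : T) (l : seq T) (ls : seq (seq T)).

Lemma sum_seq_support (F : T -> nat) (r : seq T) : uniq r ->
  (forall f, f \notin r -> F f = 0%N) -> (\sum_f F f = \sum_(f <- r) F f)%N.
Proof.
move=> Ur F0; by rewrite [RHS]big_uniq // (bigID [in r]) /= [X in (_ + X)%N]big1 ?addn0.
Qed.

(** Each permutation is uniquely [s * tperm e f] with s fixing e; f is its value at e. *)
Lemma sum_hook (w : {perm T} -> nat) e :
  (\sum_s w s = \sum_f \sum_(s : {perm T} | s e == e) w (s * tperm e f)%g)%N.
Proof.
rewrite (partition_big (fun s : {perm T} => s e) predT) //=.
apply: eq_bigr => f _; rewrite (reindex_inj (mulIg (tperm e f))) /=.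
apply: eq_bigl => s; rewrite permM -{2}(tpermL e f).
by rewrite (inj_eq perm_inj).
Qed.

Lemma mulg_tperm2 s e f : s * tperm e f * tperm e f = s.
Proof. by rewrite -mulgA tperm2 mulg1. Qed.

Lemma defect0_fix g s e : g e = e -> s \in defect 0 g -> s e = e.
Proof.
move=> ge /(defect0_porbit e)/porbitP[i ->]; rewrite permX.
by elim: i => //= i ->.
Qed.

Section Hook.
Variables (s : {perm T}) (e : T).
Hypothesis se : s e = e.

Let hook_at f : (s * tperm e f) e = f.
Proof. by rewrite permM se tpermL. Qed.

Lemma hook_none k l ls : uniq (flatten ((e :: l) :: ls)) ->
  (s \in defect k (cycs ((e :: l) :: ls))) = (s \in defect k (cycs (l :: ls))).
Proof. by move=> U; rewrite (defect_unhook _ _ se) cycs_unhook. Qed.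

Lemma hook_split k f l1 l2 ls : uniq (flatten ((e :: l1 ++ f :: l2) :: ls)) ->
  (s * tperm e f \in defect k (cycs ((e :: l1 ++ f :: l2) :: ls)))
    = (s \in defect k (cycs [:: l1, f :: l2 & ls])).
Proof.
move=> U; set g := cycs _; have g_e := porbit_cycs U (mem_head _ _) (mem_head e _).
have fe : f \in porbit g e by rewrite g_e -cat_cons mem_cat mem_head orbT.
have ne : (s * tperm e f) e != e.
  rewrite hook_at; apply: contraTneq U => -> /=.
  by rewrite mem_cat mem_cat mem_head orbT.
have := defect_hook k g ne; rewrite hook_at fe addn0 mulg_tperm2 => ->.
rewrite cycs_split // hook_none // /= -?cat_cons catA //.
Qed.

Lemma hook_merge f l1 l2 l3 ls : uniq (flatten [:: e :: l1, l2 ++ f :: l3 & ls]) ->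
  (s * tperm e f \in defect 1 (cycs [:: e :: l1, l2 ++ f :: l3 & ls]))
    = (s \in defect 0 (cycs ((l1 ++ f :: l3 ++ l2) :: ls))).
Proof.
move=> U; set g := cycs _; have g_e := porbit_cycs U (mem_head _ _) (mem_head e _).
have fe : f \notin porbit g e.
  rewrite g_e; apply: contraL U; rewrite [flatten _]/= -cat_cons cat_uniq.
  move=> fe; rewrite negb_and negb_and negbK; apply/orP; right; apply/orP; left.
  by apply/hasP; exists f; rewrite // mem_cat mem_cat mem_head orbT.
have ne : (s * tperm e f) e != e.
  by rewrite hook_at; apply: contraNneq fe => ->; apply: porbit_id.
have := defect_hook 0 g ne; rewrite hook_at fe mulg_tperm2 => ->.
rewrite cycs_merge // hook_none //.
suff P : perm_eq (flatten [:: e :: l1, l2 ++ f :: l3 & ls])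
                 (flatten ((e :: l1 ++ f :: l3 ++ l2) :: ls)).
  by rewrite -(perm_uniq P).
rewrite /= perm_cons -[X in perm_eq _ X]catA perm_cat2l perm_cat2r.
by rewrite -cat_cons perm_catC.
Qed.

End Hook.

(** The weight w lets one recursion serve both the cardinality and the size of the cycle through e.
    By [defect0_porbit], the image of e stays on [e :: l]. *)
Lemma disk_sum (w : {perm T} -> nat) e l ls :
    uniq (flatten ((e :: l) :: ls)) ->
  (\sum_(s in defect 0 (cycs ((e :: l) :: ls))) w s
    = \sum_(s in defect 0 (cycs (l :: ls))) w s
      + \sum_(i < size l) \sum_(s in defect 0 (cycs [:: take i l, drop i l & ls]))
          w (s * tperm e (nth e l i))%g)%N.
Proof.
move=> U; set g := cycs _; rewrite big_mkcond (sum_hook _ e) /=.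
rewrite (sum_seq_support (r := e :: l)); first last.
- move=> f fN; rewrite big1 // => s /eqP se; case: ifP => // /(defect0_porbit e).
  rewrite permM se tpermL (porbit_cycs U (mem_head _ _) (mem_head e _)).
  by rewrite (negPf fN).
- by move: U => /= /andP[]; rewrite mem_cat negb_or cat_uniq => /andP[-> _] /andP[].
have out f (h : {perm T}) : h e = e ->
    (\sum_(s in defect 0 h) w (s * tperm e f)%g =
     \sum_(s : {perm T} | s e == e) (if s \in defect 0 h then w (s * tperm e f)%g else 0))%N.
  move=> he; rewrite -big_mkcondr /=; apply: eq_bigl => s.
  by apply/idP/andP => [H|[]//]; split=> //; apply/eqP/(defect0_fix he).
have eN : e \notin l ++ flatten ls by case/andP: U.
rewrite big_cons; congr (_ + _)%N.
  rewrite (eq_bigr (fun s => w (s * tperm e e)%g) (P := mem (defect 0 (cycs (l :: ls)))));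
    last by move=> s _; rewrite tperm1 mulg1.
  rewrite out ?cycs_out //; apply: eq_bigr => s /eqP se.
  by rewrite tperm1 mulg1 hook_none.
rewrite (big_nth e) big_mkord; apply: eq_bigr => i _.
have lE : l = take i l ++ nth e l i :: drop i.+1 l by rewrite -drop_nth ?cat_take_drop.
rewrite out ?cycs_out //; last by rewrite /= catA cat_take_drop.
apply: eq_bigr => s /eqP se.
have := hook_split se 0 (f := nth e l i) (l1 := take i l) (l2 := drop i.+1 l) (ls := ls).
by rewrite -lE -drop_nth // => ->.
Qed.

Lemma cycs_nil_cons ls : cycs ([::] :: ls) = cycs ls.
Proof. by rewrite cycs_cons mul1g. Qed.

Lemma defect0_id : defect 0 (1 : {perm T}) = [set 1].
Proof.
apply/setP=> s; rewrite in_set1; apply/idP/eqP => [s0|->].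
  by apply/permP => x; rewrite perm1; apply: defect0_fix s0; rewrite perm1.
by rewrite inE invg1 mulg1 addn0 card_porbits1.
Qed.

Lemma disk_count ls : uniq (flatten ls) ->
  (#|defect 0 (cycs ls)| = \prod_(l <- ls) catalan (size l))%N.
Proof.
(* Removing e may add a list while deleting one entry, so entries weigh two; each list weighs one so
   that discarding an empty list also decreases the measure. *)
have [n] := ubnP (size ls + (size (flatten ls)).*2); elim: n ls => // n IH [|[|e l] ls] /ltnSE le_n U.
- have -> : cycs [::] = 1 :> {perm T} by rewrite /cycs big_nil.
  by rewrite defect0_id cards1 big_nil.
- by rewrite cycs_nil_cons IH ?big_cons ?mul1n //; move: le_n => /=; lia.
have U' : uniq (l ++ flatten ls) by case/andP: U.
rewrite /= size_cat in le_n.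
rewrite -sum1_card disk_sum // sum1_card IH //=; last by rewrite size_cat; lia.
rewrite (eq_bigr (fun i : 'I_(size l) =>
    catalan i * (catalan (size l - i) * \prod_(l <- ls) catalan (size l)))%N); last first.
  move=> i _; rewrite sum1_card IH /=; last by rewrite catA cat_take_drop.
    by rewrite !big_cons size_take size_drop ltn_ord.
  by rewrite catA cat_take_drop size_cat; lia.
rewrite !big_cons /= -catalan_conv big_ord_recr /= subnn muln1 mulnDl addnC; congr (_ + _)%N.
by rewrite big_distrl /=; apply: eq_bigr => i _; rewrite mulnA.
Qed.

Lemma card_porbit_hook s e f : s e = e -> f != e ->
  #|porbit (s * tperm e f) e| = #|porbit s f|.+1.
Proof.
move=> se fe; set l := traject s f #|porbit s f|.
have [k lE] : {k | #|porbit s f| = k.+1} by exists #|porbit s f|.-1; rewrite prednK // lt0n card_porbit_neq0.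
have sl : fcycle s l.
  have := fpath_traject s f k; rewrite /l lE /= rcons_path /= => ->.
  by rewrite last_traject -iterS -lE iter_porbit eqxx.
have Ul : uniq l by apply: uniq_traject_porbit.
have lf : l = f :: traject s (s f) k by rewrite /l lE.
have eN : e \notin l.
  rewrite /l -porbit_traject porbit_sym.
  by rewrite (porbit_fcycle (l := [:: e])) ?inE //= se eqxx.
have H : fcycle (s * tperm e f) (e :: l).
  by rewrite lf; apply: fcycle_hook; rewrite // -lf //= eN.
rewrite (eq_card (porbit_fcycle H (mem_head _ _))).
have/card_uniqP -> : uniq (e :: l) by rewrite /= eN.
by rewrite /= size_traject.
Qed.

Lemma card_porbit_fix s e : s e = e -> #|porbit s e| = 1%N.
Proof.
move=> se; have H : fcycle s [:: e] by rewrite /= se eqxx.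
by rewrite (eq_card (porbit_fcycle H (mem_head _ _))) (eq_card (mem_seq1 ^~ e)) card1.
Qed.

Lemma uniq_flatten_swap e l ls i : i < size l -> uniq (flatten ((e :: l) :: ls)) ->
  [/\ nth e l i != e, e \notin flatten [:: drop i l, take i l & ls],
     uniq (flatten [:: take i l, drop i l & ls]),
     uniq (flatten [:: drop i l, take i l & ls]) &
     perm_eq [:: take i l, drop i l & ls] [:: drop i l, take i l & ls]].
Proof.
move=> lt_i /= /andP[eN U].
have P : perm_eq [:: take i l, drop i l & ls] [:: drop i l, take i l & ls].
  by apply/seq.permP => a /=; rewrite addnCA.
have PF := perm_flatten P.
have E : flatten [:: take i l, drop i l & ls] = l ++ flatten ls.
  by rewrite /= catA cat_take_drop.
have U1 : uniq (flatten [:: take i l, drop i l & ls]) by rewrite E.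
split=> //; last by rewrite -(perm_uniq PF).
  by apply: contraNneq eN => <-; rewrite mem_cat mem_nth.
by rewrite -(perm_mem PF) E.
Qed.

(** A cycle of size m+1 through e leaves m+1 gaps in its list, filled independently, whence the
    coefficient of C^(m+1). *)
Lemma disk_block_count m e l ls : uniq (flatten ((e :: l) :: ls)) ->
  (\sum_(s in defect 0 (cycs ((e :: l) :: ls))) (#|porbit s e| == m.+1)
    = (if m <= size l then ballot (size l - m) m.+1 else 0)
      * \prod_(l <- ls) catalan (size l))%N.
Proof.
elim: m e l ls => [|m IH] e l ls U; have/andP[eN Ul] := U.
  rewrite disk_sum // [X in (_ + X)%N]big1 ?addn0 /= => [|i _].
    rewrite subn0 -(big_cons _ _ l ls xpredT (fun l => catalan (size l))) -disk_count //.
    rewrite -sum1_card; apply: eq_bigr => s s0.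
    by rewrite card_porbit_fix // (defect0_fix _ s0) // cycs_out.
  have [fe eN' _ _ P] := uniq_flatten_swap (ltn_ord i) U.
  rewrite big1 // => s s0; rewrite card_porbit_hook //.
    by rewrite eqSS (negPf (card_porbit_neq0 _ _)).
  by rewrite (defect0_fix _ s0) // cycs_out // (perm_mem (perm_flatten P)).
rewrite disk_sum // big1 /= => [|s s0]; last first.
  by rewrite card_porbit_fix // (defect0_fix _ s0) // cycs_out.
rewrite add0n.
transitivity (\sum_(i < size l) (catalan i * if m.+1 + i <= size l
    then ballot (size l - m.+1 - i) m.+1 else 0)
    * \prod_(l <- ls) catalan (size l))%N.
  apply: eq_bigr => i _; have lt_i := ltn_ord i.
  have [fe eN' Ut Ud P] := uniq_flatten_swap lt_i U.
  (* The cycle of e is that of f with e added, and f heads the second piece; swapping the pieces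
     puts f where the induction hypothesis looks. *)
  rewrite (cycs_perm Ut P) (drop_nth e) // in Ud eN' *; set f := nth e l i.
  transitivity (\sum_(s in defect 0 (cycs [:: f :: drop i.+1 l, take i l & ls]))
     (#|porbit s f| == m.+1))%N.
    apply: eq_bigr => s s0; rewrite card_porbit_hook // (defect0_fix _ s0) //.
    by rewrite cycs_out.
  rewrite IH // big_cons mulnA [(_ * catalan _)%N]mulnC size_take lt_i size_drop.
  have -> : (m <= size l - i.+1) = (m.+1 + i <= size l) by lia.
  by have -> : (size l - i.+1 - m = size l - m.+1 - i)%N by lia.
rewrite -big_distrl /=; congr (_ * _)%N; case: ltnP => [lt_m|le_m]; last first.
  by rewrite big1 // => i _; rewrite ifF ?muln0 //; lia.
rewrite -ballot_conv (big_ord_widen (size l) (fun i => catalan i * ballot (size l - m.+1 - i) m.+1)%N); last by lia.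
rewrite [LHS](bigID (fun i : 'I_(size l) => i < (size l - m.+1).+1)) /=.
rewrite [X in (_ + X)%N]big1 ?addn0 => [|i Hi]; last by rewrite ifF ?muln0 //; lia.
by apply: eq_bigr => i Hi; rewrite ifT //; lia.
Qed.

(** [defect 1] also admits a handle on one cycle or a merge of other cycles; the second condition
    singles out the merge of [l1] with [l2]. *)
Definition joining l1 l2 g : {set {perm T}} :=
  [set s in defect 1 g | has (fun x => s x \in l2) l1].

Lemma joiningE l1 l2 g s : (s \in joining l1 l2 g) =
  (s \in defect 1 g) && has (fun x => s x \in l2) l1.
Proof. by rewrite inE. Qed.

Lemma uniq_flatten_disjoint l1 l2 ls x : uniq (flatten [:: l1, l2 & ls]) ->
  x \in l1 -> x \in l2 -> False.
Proof.
move=> /= + x1 x2; rewrite cat_uniq => /and3P[_ /hasPn D _].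
by have := D x; rewrite mem_cat x2 /= x1 => /(_ isT).
Qed.

(** The point of [l1] sent into [l2] already spends the single merge that [defect1_merge] allows. *)
Lemma joining_other l1 l2 ls s e : uniq (flatten [:: l1, l2 & ls]) ->
    s \in joining l1 l2 (cycs [:: l1, l2 & ls]) ->
  s e \notin porbit (cycs [:: l1, l2 & ls]) e ->
  ((e \in l1) || (e \in l2)) /\ ((s e \in l1) || (s e \in l2)).
Proof.
move=> U; set g := cycs _; rewrite joiningE => /andP[s1 /hasP[x x1 sx2]] se.
have g1 : porbit g x =i l1 by apply: (porbit_cycs U) => //; rewrite inE eqxx.
have g2 : porbit g (s x) =i l2.
  by apply: (porbit_cycs U) => //; rewrite !inE eqxx orbT.
have sx : s x \notin porbit g x.
  by rewrite g1; apply/negP => sx1; apply: (uniq_flatten_disjoint U sx1 sx2).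
by have := defect1_merge s1 sx se; rewrite !g1 !g2.
Qed.

Lemma joining_count l1 l2 ls : uniq (flatten [:: l1, l2 & ls]) ->
  (#|joining l1 l2 (cycs [:: l1, l2 & ls])|
    = annular (size l1) (size l2) * \prod_(l <- ls) catalan (size l))%N.
Proof.
have [n] := ubnP (size l1); elim: n l1 l2 ls => // n IH [|e l] l2 ls /ltnSE le_n U.
  rewrite annular0 mul0n; apply: eq_card0 => s; by rewrite joiningE andbF.
set g := cycs _; have/andP[eN Ul] := U.
pose P := (\prod_(l <- ls) catalan (size l))%N.
rewrite -sum1_card big_mkcond (sum_hook _ e) /=.
have el2 : e \notin l2.
  by apply/negP => e2; apply: (uniq_flatten_disjoint U _ e2); rewrite mem_head.
have g_e := porbit_cycs U (mem_head _ _) (mem_head e _).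
rewrite (sum_seq_support (r := e :: l ++ l2)); first last.
- move=> f fN; rewrite big1 // => s /eqP se; case: ifP => // sJ.
  have he : (s * tperm e f) e = f by rewrite permM se tpermL.
  have := joining_other (e := e) U sJ; rewrite he g_e.
  move: fN; rewrite -cat_cons mem_cat negb_or => /andP[fl fl2].
  by rewrite (negPf fl) (negPf fl2) => /(_ isT)[].
- have : uniq ((e :: l) ++ l2 ++ flatten ls) by [].
  by rewrite catA cat_uniq => /andP[].
rewrite big_cons big_cat /= annular_rec.
(* The three terms are [s e = e], [s e] on the first cycle, and [s e] on the second. In the middle
   one the two summands say which piece stays joined to [l2]; the first term completes them to twice
   the sum in [annular_rec]. *)
transitivity (annular (size l) (size l2) * P
  + ((\sum_(i < size l) (annular i (size l2) * catalan (size l - i)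
      + annular (size l - i) (size l2) * catalan i)) * P
  + size l2 * (catalan (size l + size l2) * P)))%N; last first.
  rewrite addnA mulnA -!mulnDl; congr ((_ + _) * _)%N.
  rewrite big_split /= mul2n -addnn [X in (_ = _ + X)%N](reindex_inj rev_ord_inj) /=.
  rewrite !big_ord_recr /= subnn mul1n subSS subnn annular0 muln0 addn0.
  rewrite addnA [X in (_ = X + _)%N]addnC; congr (_ + _ + _)%N.
    by apply: eq_bigr => i _; rewrite mulnC.
  apply: eq_bigr => i _; have lt_i := ltn_ord i.
  by rewrite mulnC subSS subKn // ltnW.
congr (_ + (_ + _))%N.
- rewrite -IH // -sum1_card [RHS]big_mkcond [RHS](bigID (fun s : {perm T} => s e == e)) /=.
  rewrite [X in (_ = _ + X)%N]big1 ?addn0 => [|s se].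
    apply: eq_bigr => s /eqP se; rewrite tperm1 mulg1 !joiningE /= se (negPf el2) /=.
    by rewrite /g hook_none.
  case: ifP => // sJ; have [] := joining_other (e := e) Ul sJ.
    have ge : cycs [:: l, l2 & ls] e = e by rewrite cycs_out.
    by apply: contra se => /porbitP[i ->]; rewrite permX; elim: i => //= i /eqP ->; rewrite ge.
  move: eN; rewrite /= !mem_cat !negb_or => /and3P[/negPf-> /negPf-> _] //.
- rewrite (big_nth e) big_mkord big_distrl /=; apply: eq_bigr => i _.
  have lt_i := ltn_ord i; set f := nth e l i.
  have [fe _ Ut _ _] := uniq_flatten_swap lt_i U.
  set g' := cycs [:: take i l, drop i l, l2 & ls].
  have PA : perm_eq [:: take i l, drop i l, l2 & ls] [:: take i l, l2, drop i l & ls].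
    by apply/seq.permP => a /=; congr (_ + _)%N; rewrite addnCA.
  have PB : perm_eq [:: take i l, drop i l, l2 & ls] [:: drop i l, l2, take i l & ls].
    by apply/seq.permP => a /=; lia.
  have UA := Ut; rewrite (perm_uniq (perm_flatten PA)) in UA.
  have UB := Ut; rewrite (perm_uniq (perm_flatten PB)) in UB.
  have gA : g' = cycs _ := cycs_perm Ut PA; have gB : g' = cycs _ := cycs_perm Ut PB.
  have JA := IH _ _ _ _ UA; have JB := IH _ _ _ _ UB.
  rewrite -gA big_cons size_take size_drop lt_i in JA.
  rewrite -gB big_cons size_take size_drop lt_i in JB.
  rewrite /= in le_n; rewrite mulnDl -!mulnA -JA; last by lia.
  rewrite -JB; last by lia.
  (* Joining both pieces to [l2] would take two merges. *)
  have JAJB : joining (take i l) l2 g' :&: joining (drop i l) l2 g' = set0.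
    apply/setP => s; rewrite in_setI in_set0 andbC; apply/negP => /andP[].
    rewrite joiningE => /andP[_ /hasP[x xB sx]] sA.
    have sJ : s \in joining (take i l) l2 (cycs [:: take i l, l2, drop i l & ls]).
      by rewrite -gA.
    have x2 : x \notin l2 by apply/negP; apply: (uniq_flatten_disjoint UB xB).
    have x1 : x \notin take i l.
      by apply/negP => xA; apply: (uniq_flatten_disjoint Ut xA xB).
    have [] := joining_other (e := x) UA sJ; last by rewrite (negPf x1) (negPf x2).
    rewrite -gA gB (porbit_cycs UB (mem_head _ _) xB).
    by apply/negP => sxB; apply: (uniq_flatten_disjoint UB sxB sx).
  rewrite -cardsUI JAJB cards0 addn0 -sum1_card [RHS]big_mkcond.
  rewrite [RHS](bigID (fun s : {perm T} => s e == e)) /=.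
  have fl : f \in l by apply: mem_nth.
  have fl2 : f \notin l2.
    by apply/negP => f2; apply: (uniq_flatten_disjoint U _ f2); rewrite inE fl orbT.
  have t2 y : (tperm e f y \in l2) = (y \in l2).
    by case: tpermP => [->|->|//]; rewrite (negPf el2) (negPf fl2).
  rewrite [X in (_ = _ + X)%N]big1 ?addn0 => [|s se].
    apply: eq_bigr => s /eqP se; congr (if _ then _ else _).
    rewrite in_setU !joiningE -andb_orr -has_cat cat_take_drop.
    have := hook_split se 1 (f := f) (l1 := take i l) (l2 := drop i.+1 l) (ls := l2 :: ls).
    rewrite -drop_nth // cat_take_drop => -> //; congr (_ && _).
    rewrite [LHS]/= permM se tpermL (negPf fl2) /=.
    by apply: eq_has => x; rewrite permM t2.
  case: ifP => //; have ge : g' e = e.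
    by apply: cycs_out; rewrite /= !catA cat_take_drop -catA.
  have seN : s e \notin porbit g' e.
    by apply: contra se => /porbitP[j ->]; rewrite permX; elim: j => //= j /eqP ->; rewrite ge.
  have [eA eB] : e \notin take i l /\ e \notin drop i l.
    apply/andP; rewrite -negb_or -mem_cat cat_take_drop.
    by apply: contra eN => el; rewrite mem_cat el.
  rewrite in_setU => /orP[sJ|sJ].
    rewrite gA in sJ seN; have [] := joining_other UA sJ seN.
    by rewrite (negPf eA) (negPf el2).
  rewrite gB in sJ seN; have [] := joining_other UB sJ seN.
  by rewrite (negPf eB) (negPf el2).
(* With f on [l2] the hook merges both cycles and leaves defect 0 on a single cycle, whose length
   does not depend on f. *)
transitivity (\sum_(f <- l2) catalan (size l + size l2) * P)%N; last first.
  by rewrite big_const_seq count_predT iter_addn_0 mulnC.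
rewrite [LHS]big_seq [RHS]big_seq; apply: eq_bigr => f f2.
have gE : g = cycs [:: e :: l, l2 & ls] by []; move: g gE g_e => g gE _.
case/splitPr: f2 U gE el2 Ul eN IH => m1 m2 U gE el2 Ul eN _.
have U3 : uniq (flatten ((l ++ f :: m2 ++ m1) :: ls)).
  suff Pm : perm_eq (flatten [:: l, m1 ++ f :: m2 & ls]) (flatten ((l ++ f :: m2 ++ m1) :: ls)).
    by rewrite -(perm_uniq Pm).
  by rewrite /= -[X in perm_eq _ X]catA perm_cat2l perm_cat2r -cat_cons perm_catC.
have -> : (size l + size (m1 ++ f :: m2) = size (l ++ f :: m2 ++ m1))%N.
  by rewrite !size_cat /= !size_cat; lia.
rewrite /P -(big_cons _ _ (l ++ f :: m2 ++ m1) ls xpredT (fun l => catalan (size l))) -disk_count // -sum1_card [RHS]big_mkcond.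
rewrite [RHS](bigID (fun s : {perm T} => s e == e)) /=.
have ge : cycs ((l ++ f :: m2 ++ m1) :: ls) e = e.
  apply: cycs_out; move: eN; rewrite /= !(mem_cat, inE); apply: contra.
  by case/orP => [/or4P[]|] ->; rewrite ?orbT.
rewrite [X in (_ = _ + X)%N]big1 ?addn0 => [|s se].
  apply: eq_bigr => s /eqP se; rewrite joiningE gE hook_merge // [has _ _]/= permM se tpermL.
  by rewrite mem_cat mem_head orbT andbT.
by case: ifP => // /(defect0_fix ge)/eqP; rewrite (negPf se).
Qed.

End Counting.

(** * Non-crossing permutations *)

Section Noncrossing.
Local Open Scope group_scope.

Lemma mem_porbit_closed (T : finType) (s : {perm T}) (A : pred T) x y :
  (forall z, A z -> A (s z)) -> y \in porbit s x -> A x -> A y.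
Proof. by move=> sA /porbitP[i ->] Ax; rewrite permX; elim: i => //= i; apply: sA. Qed.

Lemma porbit_trans (T : finType) (u : {perm T}) x y z :
  y \in porbit u x -> z \in porbit u y -> z \in porbit u x.
Proof. by rewrite -!eq_porbit_mem => /eqP ->. Qed.

Lemma porbit_unhook (T : finType) (s : {perm T}) e x y :
  s e != e -> x != e -> y != e ->
  (y \in porbit (s * tperm e (s e)) x) = (y \in porbit s x).
Proof.
move=> se xe ye; set s' := s * _.
have s'E z : s' z = if s z == e then s e else if z == e then e else s z.
  rewrite permM; case: tpermP => [->|/perm_inj->|/eqP/negPf-> szf].
  - by rewrite eqxx.
  - by rewrite (negPf se) eqxx.
  - by rewrite ifF //; apply/eqP => ze; rewrite ze in szf.
have step (u : {perm T}) z w : z \in porbit u w -> u z \in porbit u w.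
  by case/porbitP => j ->; rewrite -permM -expgSr mem_porbit.
apply/idP/idP => yx.
  apply: (mem_porbit_closed (A := [in porbit s x]) _ yx) (porbit_id _ _) => z zx /=.
  rewrite s'E; case: eqP => [sze|_]; first by rewrite -{1}sze; apply: (step s); apply: (step s).
  by case: eqP => [<-|_] //; apply: step.
pose A z := if z == e then s e \in porbit s' x else z \in porbit s' x.
suff : A y by rewrite /A (negPf ye).
apply: (mem_porbit_closed _ yx) => [z|]; rewrite /A; last by rewrite (negPf xe) porbit_id.
have [->|ze] := eqVneq z e; first by rewrite (negPf se).
move=> /= zx; have := step s' _ _ zx; rewrite s'E (negPf ze).
by case: ifP.
Qed.

Variable n : nat.
Implicit Types (s : 'S_n) (e f x y i j k m : 'I_n) (l : seq 'I_n) (ls : seq (seq 'I_n)).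

(** The conditions of [NC] relative to a list of cycles, so that they survive cutting: crossings are
    tested only inside one list. [ncw_incr] says without a starting point that cycles increase: a
    step that does not go up lands on the least element of its cycle. *)
Record nc_within ls s : Prop := NcWithin {
  ncw_out : forall x, x \notin flatten ls -> s x = x;
  ncw_mem : forall l x, l \in ls -> x \in l -> s x \in l;
  ncw_nc : forall l i j k m, l \in ls ->
    i \in l -> j \in l -> k \in l -> m \in l -> (i < j)%N -> (j < k)%N -> (k < m)%N ->
    k \in porbit s i -> m \in porbit s j -> j \in porbit s i;
  ncw_incr : forall x y, (s x <= x)%N -> y \in porbit s x -> (s x <= y)%N }.

Lemma ncw_porbit ls s l x y : nc_within ls s -> l \in ls -> x \in l ->
  y \in porbit s x -> y \in l.
Proof.
move=> H lls xl yx; apply: (mem_porbit_closed (A := [in l]) _ yx xl) => z.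
exact: (ncw_mem H).
Qed.

(** Going along the cycle from its least element e, the values rise until the return to e. *)
Lemma ncw_gap ls s l e x : nc_within ls s -> l \in ls -> e \in l ->
  (forall y, y \in l -> (e <= y)%N) -> x \in porbit s e -> x != e -> (s e <= x)%N.
Proof.
move=> H lls el le_e xe ne.
pose A z := (z \in porbit s e) && ((z == e) || (s e <= z)%N).
suff : A x by rewrite /A (negPf ne) => /andP[].
apply: (mem_porbit_closed _ xe); last by rewrite /A porbit_id eqxx.
move=> z /andP[ze zA]; have sz : s z \in porbit s e.
  by case/porbitP: ze => j ->; rewrite -permM -expgSr mem_porbit.
rewrite /A sz /=; case/predU1P: zA => [->|zA]; first by rewrite leqnn orbT.
have [le_sz|lt_z] := leqP (s z) z; last by rewrite (leq_trans zA) ?orbT // ltnW.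
have szl : s z \in l := ncw_porbit H lls el sz.
have ez : e \in porbit s z by rewrite porbit_sym.
by rewrite -val_eqE /= eqn_leq (ncw_incr H le_sz ez) le_e.
Qed.

Lemma nc_within_unhook e l ls s : (forall y, y \in l -> (e < y)%N) ->
    uniq (flatten ((e :: l) :: ls)) -> s e = e ->
  nc_within ((e :: l) :: ls) s <-> nc_within (l :: ls) s.
Proof.
move=> lt_e /= /andP[eN U] se.
have pe y : y \in porbit s e -> y = e.
  by case/porbitP => i ->; rewrite permX; elim: i => //= i ->.
move: eN; rewrite mem_cat negb_or => /andP[el els].
split=> [[o me nc inc]|[o me nc inc]]; split=> //.
- move=> x xN; have [->//|ne] := eqVneq x e.
  by apply: o; rewrite /= inE negb_or ne.
- move=> l' x; rewrite inE => /predU1P[->|l'ls] xl; last first.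
    by apply: me => //; rewrite inE l'ls orbT.
  have := me _ x (mem_head _ _); rewrite !inE xl orbT => /(_ isT) /predU1P[sxe|//].
  by move: el; rewrite -(@perm_inj _ s x e) ?xl // sxe se.
- move=> l' i j k m; rewrite inE => /predU1P[->|l'ls] il jl kl ml.
    by apply: (nc _ _ _ _ _ (mem_head _ _)); rewrite inE ?il ?jl ?kl ?ml orbT.
  by apply: (nc _ _ _ _ _ _ il jl kl ml); rewrite inE l'ls orbT.
- by move=> x; rewrite /= inE negb_or => /andP[_]; apply: o.
- move=> l' x; rewrite inE => /predU1P[->|l'ls]; last first.
    by apply: me; rewrite inE l'ls orbT.
  rewrite inE => /predU1P[->|xl]; first by rewrite se mem_head.
  by rewrite inE (me _ _ (mem_head _ _) xl) orbT.
move=> l' i j k m; rewrite inE => /predU1P[->|l'ls]; last first.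
  by apply: nc; rewrite inE l'ls orbT.
move=> il jl kl ml ij jk km ki mj; move: il jl kl ml; rewrite !inE.
have [iE|_ /=] := eqVneq i e.
  by rewrite iE in ki ij; rewrite (pe _ ki) in jk; clear -ij jk; lia.
have [jE|_ /=] := eqVneq j e.
  by rewrite jE in mj jk; rewrite (pe _ mj) in km; clear -jk km; lia.
have [kE|_ /=] := eqVneq k e.
  by rewrite kE porbit_sym in ki; have ie := pe _ ki; rewrite ie kE in ij jk; clear -ij jk; lia.
have [mE|_ /=] := eqVneq m e.
  by rewrite mE porbit_sym in mj; have je := pe _ mj; rewrite je mE in jk km; clear -jk km; lia.
by move=> il jl kl ml; apply: (nc _ _ _ _ _ (mem_head _ _) il jl kl ml).
Qed.

Lemma nc_within_hook e f l1 l2 ls s :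
    sorted ltn (map val (e :: l1 ++ f :: l2)) ->
    uniq (flatten ((e :: l1 ++ f :: l2) :: ls)) -> s e = f ->
  nc_within ((e :: l1 ++ f :: l2) :: ls) s
    <-> nc_within [:: l1, f :: l2 & ls] (s * tperm e f).
Proof.
rewrite (sorted_pairwise ltn_trans) pairwise_map /= pairwise_cat /=.
case/and5P=> /allP /= lt_e /allrelP /= lt_l1 _ /allP /= lt_f _.
set L := l1 ++ f :: l2 => /andP[eN U] se.
have fL : f \in L by rewrite mem_cat mem_head orbT.
have nfe : f != e by apply: contraTneq (lt_e _ fL) => ->; rewrite ltnn.
have L_e x : x \in L -> x != e.
  by move=> /lt_e; apply: contraTneq => ->; rewrite ltnn.
have out_e l x : l \in ls -> x \in l -> (x != e) && (x != f).
  move=> lls xl; have xls : x \in flatten ls by apply/flattenP; exists l.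
  apply/andP; split; first by apply: contraNneq eN => <-; rewrite mem_cat xls orbT.
  move: U; rewrite cat_uniq => /and3P[_ /hasPn /(_ _ xls) /= xL _].
  by apply: contraNneq xL => ->.
have se' : s e != e by rewrite se.
have s'e : (s * tperm e f) e = e by rewrite permM se tpermR.
have s'x x : (s * tperm e f) x = tperm e f (s x) by rewrite permM.
have po x y : x != e -> y != e -> (y \in porbit (s * tperm e f) x) = (y \in porbit s x).
  by move=> xe ye; rewrite -se porbit_unhook.
move: s'e s'x po; set s' := s * _ => s'e s'x po.
have sx x : s x = tperm e f (s' x) by rewrite s'x tpermK.
have pe x : x \in porbit s' e -> x = e.
  by case/porbitP => i ->; rewrite permX; elim: i => //= i ->.
have fe : f \in porbit s e by rewrite -se perm_in_porbit.
split=> H.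
- have le_e y : y \in e :: L -> (e <= y)%N.
    by rewrite inE => /predU1P[->//|/lt_e/ltnW].
  have gap x : x \in porbit s e -> x != e -> (f <= x)%N.
    move=> xe ne; rewrite -se.
    exact: (ncw_gap H (mem_head _ _) (mem_head _ _) le_e xe ne).
  (* As e < u < f and f = [s e] is the next element of the cycle of e, u lies on another cycle; a v
     beyond f on that cycle would give the crossing e < u < f < v. *)
  have sep u v : u \in l1 -> v \in f :: l2 -> v \notin porbit s u.
    move=> u1 v2; have uL : u \in L by rewrite mem_cat u1.
    have vL : v \in L by rewrite mem_cat v2 orbT.
    have ltuf : (u < f)%N by apply: lt_l1; rewrite ?mem_head.
    have uN : u \notin porbit s e.
      by apply/negP => /gap/(_ (L_e _ uL)); rewrite leqNgt ltuf.
    apply: contra uN => vu; move: v2; rewrite inE => /predU1P[vf|v2].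
      by rewrite vf porbit_sym in vu; apply: porbit_trans fe vu.
    have vL' : v \in L by rewrite mem_cat inE v2 !orbT.
    have sub x : x \in L -> x \in e :: L by rewrite inE => ->; rewrite orbT.
    exact: (ncw_nc H (mem_head _ _) (mem_head _ _) (sub _ uL) (sub _ fL)
              (sub _ vL') (lt_e _ uL) ltuf (lt_f _ v2) fe vu).
  have sL x : x \in L -> s' x \in L.
    move=> xL; have := ncw_mem H (mem_head _ _) (_ : x \in e :: L).
    rewrite inE xL orbT => /(_ isT); rewrite s'x inE.
    case: tpermP => [_ _|sxf _|/eqP/negPf-> _ //]; first exact: fL.
    by have := L_e _ xL; rewrite -(inj_eq (@perm_inj _ s)) sxf se eqxx.
  have s'_in x : x \in L -> s' x \in porbit s x.
    by move=> xL; rewrite -po ?perm_in_porbit ?L_e ?sL.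
  split.
  + move=> x; rewrite /= -cat_cons catA -/L => xN; have [->//|xe] := eqVneq x e.
    rewrite s'x (ncw_out H) ?tpermD //; first by rewrite eq_sym.
      by apply: contraNneq xN => <-; rewrite mem_cat fL.
    by rewrite /= inE negb_or xe.
  + move=> l' x; rewrite !inE => /or3P[/eqP->|/eqP->|l'ls] xl.
    * have xL : x \in L by rewrite mem_cat xl.
      have := sL _ xL; rewrite mem_cat => /orP[//|H2].
      by have := sep _ _ xl H2; rewrite s'_in.
    * have xL : x \in L by rewrite mem_cat xl orbT.
      have := sL _ xL; rewrite mem_cat => /orP[H2|//].
      by have := sep _ _ H2 xl; rewrite porbit_sym s'_in.
    have sxl : s x \in l' by apply: (ncw_mem H); rewrite // inE l'ls orbT.
    have /andP[ne nf] := out_e _ _ l'ls sxl.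
    by rewrite s'x tpermD // eq_sym.
  + move=> l' i j k m l'in il jl kl ml ij jk km.
    have [l'' [l''in sub neq]] : exists l'', [/\ l'' \in (e :: L) :: ls,
       {subset l' <= l''} & {in l', forall x, x != e}].
      move: l'in; rewrite !inE => /or3P[/eqP->|/eqP->|l'ls].
      - exists (e :: L); split; first exact: mem_head.
          by move=> x xl; rewrite inE mem_cat xl orbT.
        by move=> x xl; apply: L_e; rewrite mem_cat xl.
      - exists (e :: L); split; first exact: mem_head.
          by move=> x xl; rewrite inE mem_cat xl !orbT.
        by move=> x xl; apply: L_e; rewrite mem_cat xl orbT.
      exists l'; split=> //; first by rewrite inE l'ls orbT.
      by move=> x /(out_e _ _ l'ls)/andP[].
    rewrite !po ?neq // => ki mj.
    exact: (ncw_nc H l''in (sub _ il) (sub _ jl) (sub _ kl) (sub _ ml) ij jk km ki mj).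
  move=> x y; have [->|xe] := eqVneq x e.
    by rewrite s'e => _ /pe ->.
  have [->|ye] := eqVneq y e; first by rewrite porbit_sym => _ /pe xE; rewrite xE eqxx in xe.
  rewrite po // s'x; case: tpermP => [sxe _ yx|sxf|_ _].
  + apply: gap ye; apply: porbit_trans yx.
    by rewrite porbit_sym -sxe perm_in_porbit.
  + by rewrite -(inj_eq (@perm_inj _ s)) sxf se eqxx in xe.
  exact: (ncw_incr H).
(* Conversely, e is put back just before f, the least point of [f :: l2]. A crossing that starts at
   e would then be one that starts at f, and [l1] lies entirely below f. *)
have L1 : l1 \in [:: l1, f :: l2 & ls] by rewrite mem_head.
have L2 : f :: l2 \in [:: l1, f :: l2 & ls] by rewrite !inE eqxx orbT.
have Ls l' : l' \in ls -> l' \in [:: l1, f :: l2 & ls] by rewrite !inE => ->; rewrite !orbT.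
have dis x : x \in l1 -> x \in f :: l2 -> False.
  move=> x1; have lt := lt_l1 x f x1 (mem_head _ _).
  rewrite inE => /predU1P[xf|/lt_f]; first by rewrite xf ltnn in lt.
  by rewrite ltnNge ltnW.
have po_e x : x != e -> (x \in porbit s e) = (x \in porbit s' f).
  move=> xe; rewrite po //; apply/idP/idP; last exact: porbit_trans.
  by apply: porbit_trans; rewrite porbit_sym.
have po_L x y : x \in L -> y \in porbit s' x -> y \in L.
  rewrite !mem_cat => /orP[xl|xl] yx; first by rewrite (ncw_porbit H L1 xl yx).
  by rewrite (ncw_porbit H L2 xl yx) orbT.
have sL x : x \in e :: L -> s x \in e :: L.
  rewrite !inE => /predU1P[->|xL]; first by rewrite se fL orbT.
  have := po_L _ _ xL (perm_in_porbit s' x); rewrite sx.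
  by case: tpermP => [->|->|_ _ ->]; rewrite ?eqxx ?fL ?orbT.
have le_e x y : x \in e :: L -> y \in porbit s x -> (e <= y)%N.
  move=> xL yx; have : y \in e :: L by apply: (mem_porbit_closed (A := [in e :: L]) _ yx xL).
  by rewrite inE => /predU1P[->//|/lt_e/ltnW].
split.
- move=> x; rewrite /= inE negb_or => /andP[xe xN].
  rewrite sx (ncw_out H) ?tpermD //; first by rewrite eq_sym.
    by apply: contraNneq xN => <-; rewrite mem_cat fL.
  by rewrite /= -cat_cons catA.
- move=> l' x; rewrite inE => /predU1P[->|l'ls xl]; first exact: sL.
  have sxl : s' x \in l' := ncw_mem H (Ls _ l'ls) xl.
  have /andP[ne nf] := out_e _ _ l'ls sxl.
  by rewrite sx tpermD // eq_sym.
- move=> l' i j k m; rewrite inE => /predU1P[->|l'ls]; last first.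
    move=> il jl kl ml ij jk km; have ne x : x \in l' -> x != e by move=> /(out_e _ _ l'ls)/andP[].
    by rewrite -!po ?ne //; apply: (ncw_nc H (Ls _ l'ls)).
  move=> il jl kl ml ij jk km ki mj.
  have lei : (e <= i)%N by apply: le_e il (porbit_id _ _).
  have ne x : x \in e :: L -> (i < x)%N -> (x != e) && (x \in L).
    rewrite inE => + ix; case: eqVneq => [xe|] //=.
    by rewrite xe ltnNge lei in ix.
  have /andP[je jL] := ne _ jl ij.
  have /andP[ke kL] := ne _ kl (ltn_trans ij jk).
  have /andP[me mL] := ne _ ml (ltn_trans ij (ltn_trans jk km)).
  rewrite -po // in mj; move: il; rewrite inE => /predU1P[iE|iL].
    rewrite iE po_e // in ki; rewrite iE po_e //; have k2 := ncw_porbit H L2 (mem_head _ _) ki.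
    have lefk : (f <= k)%N by move: k2; rewrite inE => /predU1P[->//|/lt_f/ltnW].
    move: jL; rewrite mem_cat => /orP[j1|j2].
      have m1 := ncw_porbit H L1 j1 mj; have := lt_l1 m f m1 (mem_head _ _); clear -jk km lefk; lia.
    have m2 := ncw_porbit H L2 j2 mj.
    move: (j2); rewrite inE => /predU1P[->|/lt_f fj]; first exact: porbit_id.
    exact: (ncw_nc H L2 (mem_head _ _) j2 k2 m2 fj jk km ki mj).
  have ie := L_e _ iL; rewrite -po // in ki; rewrite -po //.
  move: iL; rewrite mem_cat => /orP[i1|i2].
    have k1 := ncw_porbit H L1 i1 ki.
    have j1 : j \in l1.
      move: jL; rewrite mem_cat => /orP[//|]; have := lt_l1 k f k1 (mem_head _ _).
      rewrite inE => ltkf /predU1P[jE|/lt_f]; last by clear -jk ltkf; lia.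
      by rewrite jE in jk; clear -jk ltkf; lia.
    have m1 := ncw_porbit H L1 j1 mj.
    exact: (ncw_nc H L1 i1 j1 k1 m1 ij jk km ki mj).
  have lefi : (f <= i)%N by move: i2; rewrite inE => /predU1P[->//|/lt_f/ltnW].
  have k2 := ncw_porbit H L2 i2 ki.
  have j2 : j \in f :: l2.
    move: jL; rewrite mem_cat => /orP[j1|//]; have := lt_l1 j f j1 (mem_head _ _); clear -lefi ij; lia.
  have m2 := ncw_porbit H L2 j2 mj.
  exact: (ncw_nc H L2 i2 j2 k2 m2 ij jk km ki mj).
move=> x y; have [->|xe] := eqVneq x e.
  by rewrite se leqNgt lt_e.
have s'xe : s' x != e by rewrite -s'e (inj_eq perm_inj).
rewrite sx; case: tpermP => [E|s'xf _ yx|/eqP ne /eqP nf lesx]; first by rewrite E eqxx in s'xe.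
  have sxe : s x = e by rewrite sx s'xf tpermR.
  by apply: (le_e e); rewrite ?mem_head //; apply: porbit_trans yx; rewrite porbit_sym -sxe perm_in_porbit.
have [->|ye] := eqVneq y e; last by rewrite -po //; apply: (ncw_incr H).
rewrite porbit_sym po_e // porbit_sym => fx.
have := ncw_incr H lesx fx; have : s' x \in f :: l2.
  by apply: (ncw_porbit H L2 (mem_head _ _)); apply: porbit_trans (perm_in_porbit s' x); rewrite porbit_sym.
rewrite inE (negPf nf) /= => /lt_f; clear; lia.
Qed.

(** Removing the head e, the least point of its sorted list, changes both sides in the same way; if
    [s e] is off that list, both sides fail. *)
Lemma nc_within_defect ls s : uniq (flatten ls) ->
    (forall l, l \in ls -> sorted ltn (map val l)) ->
  nc_within ls s <-> s \in defect 0 (cycs ls).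
Proof.
have [k] := ubnP (size ls + (size (flatten ls)).*2); elim: k ls s => // k IH [|[|e l] ls] s /ltnSE le_k U S.
- have -> : cycs [::] = 1 :> 'S_n by rewrite /cycs big_nil.
  rewrite defect0_id in_set1; split=> [H|/eqP->].
    by apply/eqP/permP => x; rewrite perm1 (ncw_out H).
  split=> //; first by move=> x; rewrite perm1.
  by move=> x y _ /porbitP[i ->]; rewrite !perm1 expg1n perm1.
- rewrite cycs_nil_cons -IH //; last first.
    by move=> l lls; apply: S; rewrite inE lls orbT.
  split=> [[o me nc inc]|[o me nc inc]]; split=> //.
  + by move=> l x lls; apply: me; rewrite inE lls orbT.
  + by move=> l i j x m lls; apply: nc; rewrite inE lls orbT.
  + by move=> l x; rewrite inE => /predU1P[->//|]; apply: me.
  by move=> l i j x m; rewrite inE => /predU1P[->//|]; apply: nc.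
have Sl := S _ (mem_head _ _); have/andP[eN Ul] := U.
have lt_e y : y \in l -> (e < y)%N.
  move: Sl; rewrite (sorted_pairwise ltn_trans) pairwise_map /= => /andP[/allP H _].
  exact: H.
have [se|se] := eqVneq (s e) e.
  rewrite hook_none // nc_within_unhook // -IH //.
  + by move: le_k => /=; lia.
  move=> l'; rewrite inE => /predU1P[->|l'ls]; last by apply: S; rewrite inE l'ls orbT.
  by move: Sl => /= /path_sorted.
have [sel|seN] := boolP (s e \in l); last first.
  split=> [H|s0].
    have := ncw_mem H (mem_head _ _) (mem_head e l).
    by rewrite inE (negPf se) (negPf seN).
  have := defect0_porbit e s0; rewrite (porbit_cycs U (mem_head _ _) (mem_head e l)).
  by rewrite inE (negPf se) (negPf seN).
move fE : (s e) => f; rewrite fE in se sel.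
case/splitPr: sel IH le_k U S Sl eN Ul lt_e => l1 l2 IH le_k U S Sl eN Ul lt_e.
have s'e : (s * tperm e f) e = e by rewrite permM fE tpermR.
have U2 : uniq (flatten [:: l1, f :: l2 & ls]).
  have : uniq ((l1 ++ f :: l2) ++ flatten ls) := Ul.
  by rewrite -catA.
rewrite nc_within_hook // IH //.
- by rewrite -(hook_split s'e) // mulg_tperm2.
- by move: le_k => /=; rewrite !size_cat /= !size_cat /=; lia.
move=> l'; rewrite !inE => /or3P[/eqP->|/eqP->|l'ls].
- by move: Sl; rewrite /= map_cat => /path_sorted/cat_sorted2[].
- by move: Sl; rewrite /= map_cat => /path_sorted/cat_sorted2[].
by apply: S; rewrite inE l'ls orbT.
Qed.

End Noncrossing.

(** * NC(n) as the defect 0 permutations, and its blocks by size *)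

Section NCCount.
Local Open Scope group_scope.

Lemma mem_porbits (T : finType) (s : {perm T}) x : porbit s x \in porbits s.
Proof. exact: imset_f. Qed.

Lemma gamma_fcycle n : fcycle (gamma n) (enum 'I_n).
Proof.
apply: cycle_from_next => [|x _]; first exact: enum_uniq.
case: n x => [[]//|n] x.
have gE : val (gamma n.+1 x) = (x.+1 %% n.+1)%N by rewrite permE.
apply/eqP/val_inj; rewrite [LHS]gE next_nth mem_enum enum_ordSl -enum_ordSl.
rewrite index_enum_ord; have := ltn_ord x; rewrite ltnS leq_eqVlt => /predU1P[xn|ltx].
  by rewrite [in LHS]xn modnn nth_default // size_map size_enum_ord xn.
by rewrite (nth_map (Ordinal ltx)) ?size_enum_ord //= nth_enum_ord // modn_small.
Qed.

Lemma gamma_cycs n l : uniq l -> size l = n -> fcycle (gamma n) l -> gamma n = cycs [:: l].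
Proof.
move=> U sl gl; apply: eq_cycs; rewrite /= ?cats0 //.
  by move=> l'; rewrite inE => /eqP->.
move=> x /negP[]; have [||_ ->] := uniq_min_size (s1 := l) (s2 := enum 'I_n) U.
- by move=> y _; rewrite mem_enum.
- by rewrite size_enum_ord sl.
by rewrite mem_enum.
Qed.

Lemma gamma_enum n : gamma n = cycs [:: enum 'I_n].
Proof. by apply: gamma_cycs (gamma_fcycle n); rewrite ?enum_uniq ?size_enum_ord. Qed.

(** Since [defect 0 (gamma n)] does not see the numbering, any e may be placed at the head, where
    [disk_block_count] applies. *)
Lemma gamma_rot n (e : 'I_n) : exists l,
  [/\ uniq (flatten [:: e :: l]), (size l).+1 = n & gamma n = cycs [:: e :: l]].
Proof.
have en : e \in enum 'I_n by rewrite mem_enum.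
have [m1 [m2 E]] : exists m1 m2, enum 'I_n = m1 ++ e :: m2.
  by case/splitPr: en => m1 m2; exists m1, m2.
have P : perm_eq (m1 ++ e :: m2) (e :: m2 ++ m1) by rewrite perm_catC.
have U : uniq (e :: m2 ++ m1) by rewrite -(perm_uniq P) -E enum_uniq.
have S : size (e :: m2 ++ m1) = n by rewrite -(perm_size P) -E size_enum_ord.
exists (m2 ++ m1); split=> //; first by rewrite [flatten _]/= cats0.
apply: gamma_cycs => //; have := gamma_fcycle n; rewrite E.
by rewrite -cat_cons -(rot_size_cat m1) rot_cycle.
Qed.

Variable n : nat.
Implicit Types (s : 'S_n) (c : {set 'I_n}).

Lemma sorted_enum (A : {set 'I_n}) : sorted ltn (map val (enum A)).
Proof.
have := iota_ltn_sorted 0 n; rewrite -val_enum_ord.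
apply: subseq_sorted; first exact: ltn_trans.
by apply: map_subseq; rewrite {1}/enum_mem -enumT; apply: filter_subseq.
Qed.

Lemma cycle_seqE s c : c \in porbits s ->
  exists i, [/\ c = porbit s i, {in c, forall j : 'I_n, (i <= j)%N}
           & cycle_seq s c = traject s i #|c| ].
Proof.
case/imsetP => x _ cE; rewrite /cycle_seq; case E : (enum c) => [|i r].
  by have := mem_enum c x; rewrite E in_nil cE porbit_id.
have ic : i \in c by rewrite -mem_enum E mem_head.
exists i; split=> //; first by apply/eqP; rewrite cE eq_sym eq_porbit_mem -cE.
move=> j; rewrite -mem_enum E inE => /predU1P[->//|jr].
have := sorted_enum c; rewrite E /= (path_sortedE ltn_trans) => /andP[/allP H _].
exact/ltnW/H/map_f.
Qed.

Lemma nc_within_NC s : nc_within [:: enum 'I_n] s <-> s \in NC n.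
Proof.
rewrite inE; split=> [H|/andP[/forall_inP nc /forall_inP srt]].
  apply/andP; split; apply/forall_inP.
    move=> B /imsetP[b _ BE]; apply/forall_inP => D /imsetP[d _ DE].
    apply/implyP => BD; apply/exists_inP => -[i iB /exists_inP[j jD /exists_inP[k kB]]].
    move=> /exists_inP[m mD /and3P[ij jk km]]; case/negP: BD.
    have iB' : B = porbit s i by apply/eqP; rewrite BE eq_sym eq_porbit_mem -BE.
    have jD' : D = porbit s j by apply/eqP; rewrite DE eq_sym eq_porbit_mem -DE.
    rewrite iB' in kB *; rewrite jD' in mD *; rewrite eq_sym eq_porbit_mem.
    by apply: (ncw_nc H (mem_head _ _) _ _ _ _ ij jk km kB mD); rewrite mem_enum.
  move=> c /cycle_seqE[i [cE ic ->]]; apply/(sortedP 0%N) => k.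
  rewrite size_map size_traject => ltk.
  rewrite !(nth_map i) ?size_traject ?(ltnW ltk) // !nth_traject ?(ltnW ltk) //.
  (* A step that does not go up would return to the least element i in fewer than [#|c|] steps. *)
  rewrite /= ltnNge; apply/negP => le; have := ncw_incr H le (y := i).
  rewrite porbit_sym -permX mem_porbit => /(_ isT) lei.
  have sic : iter k.+1 s i \in c by rewrite cE -permX mem_porbit.
  have {}sic : iter k.+1 s i = i.
    by apply/val_inj/eqP; rewrite eqn_leq ic // andbT /= -permX.
  have := uniq_traject_porbit s i; rewrite -cE.
  case E : #|c| ltk => [|k'] // ltk /= /andP[/negP[]].
  by apply/trajectP; exists k => //; rewrite -iterSr.
split.
- by move=> x; rewrite /= cats0 mem_enum.
- by move=> l x; rewrite inE => /eqP->; rewrite !mem_enum.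
- move=> l i j k m _ _ _ _ _ ij jk km ki mj.
  rewrite -eq_porbit_mem; apply: contraT => ne.
  have /forall_inP/(_ (porbit s j) (mem_porbits s j)) := nc _ (mem_porbits s i).
  rewrite eq_sym ne => /negP[].
  apply/exists_inP; exists i; first exact: porbit_id.
  apply/exists_inP; exists j; first exact: porbit_id.
  apply/exists_inP; exists k => //.
  by apply/exists_inP; exists m => //; rewrite ij jk.
move=> x y le yx; have cs := mem_porbits s x.
have [i [cE ic E]] := cycle_seqE cs; have := srt _ cs; rewrite E => /(sortedP 0%N) S.
have : x \in traject s i #|porbit s x| by rewrite cE -porbit_traject -cE porbit_id.
case/trajectP => k ltk xE; have [ltk1|lek] := ltnP k.+1 #|porbit s x|.
  have := S k; rewrite size_map size_traject => /(_ ltk1).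
  rewrite !(nth_map i) ?size_traject // !nth_traject // iterS -xE.
  by rewrite /= ltnNge le.
have kE : k.+1 = #|porbit s x| by apply/eqP; rewrite eqn_leq ltk.
have -> : s x = i by rewrite {1}xE -iterS kE cE iter_porbit.
exact: ic.
Qed.

Lemma NC_defect : NC n = defect 0 (gamma n).
Proof.
have [U S] : uniq (flatten [:: enum 'I_n]) /\
    forall l, l \in [:: enum 'I_n] -> sorted ltn (map val l).
  split; first by rewrite /= cats0 enum_uniq.
  by move=> l; rewrite inE => /eqP->; rewrite val_enum_ord iota_ltn_sorted.
apply/setP => s; rewrite gamma_enum; apply/idP/idP => H.
  by apply/(nc_within_defect s U S)/nc_within_NC.
by apply/nc_within_NC/(nc_within_defect s U S).
Qed.

Lemma card_NC : #|NC n| = catalan n.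
Proof.
rewrite NC_defect gamma_enum disk_count ?big_seq1 ?size_enum_ord //.
by rewrite /= cats0 enum_uniq.
Qed.

Definition blocks_of_size s m : nat := #|[set c in porbits s | #|c| == m]|.

Lemma sum_porbit_size s m :
  (\sum_(e : 'I_n) (#|porbit s e| == m) = m * blocks_of_size s m)%N.
Proof.
rewrite (partition_big (porbit s) [in porbits s]) /=; last by move=> e _; apply: imset_f.
rewrite /blocks_of_size -sum1_card big_distrr /=.
rewrite [RHS](eq_bigl (fun c => (c \in porbits s) && (#|c| == m))); last first.
  by move=> c; rewrite inE.
rewrite big_mkcondr /=; apply: eq_bigr => c cs.
rewrite (eq_bigr (fun=> (#|c| == m) : nat)) => [|e /eqP-> //].
rewrite sum_nat_const; case: eqP => [cm|]; rewrite ?muln0 //= !muln1 -cm.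
case/imsetP: cs => x _ ->; apply: eq_card => e; rewrite -[in RHS]eq_porbit_mem.
by [].
Qed.

(** Count the pairs (s, e) with e on a cycle of size m: each block is met m times, and each of the n
    points e gives [ballot (n - m) m]. Then [ballot_mul] applies. *)
Lemma sum_blocks_of_size m : (0 < m <= n)%N ->
  (\sum_(s in NC n) blocks_of_size s m = 'C(n.*2 - m.+1, n - m))%N.
Proof.
case: m => // m /= lt_mn; apply/eqP; rewrite -(eqn_pmul2l (ltn0Sn m)); apply/eqP.
rewrite big_distrr /= -(eq_bigr _ (fun s _ => sum_porbit_size s m.+1)) exchange_big /=.
have -> : ('C(n.*2 - m.+2, n - m.+1) = 'C((n - m.+1).*2 + m, n - m.+1))%N.
  by congr 'C(_, _); lia.
rewrite -ballot_mul subnK //.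
rewrite (eq_bigr (fun=> ballot (n - m.+1) m.+1)); last first.
  move=> e _; have [l [U sl gE]] := gamma_rot e.
  have {}sl : size l = n.-1 := congr1 predn sl.
  rewrite NC_defect gE disk_block_count // big_nil muln1 sl ifT; last by lia.
  by congr ballot; lia.
by rewrite sum_nat_const card_ord.
Qed.

End NCCount.

(** * Annular non-crossing permutations *)

Section AnnularCount.
Local Open Scope group_scope.
Variables p q : nat.

Lemma perm_suml (s : 'S_p) (t : 'S_q) i : perm_sum s t (lshift q i) = lshift q (s i).
Proof. by rewrite permE /perm_sum_fun (unsplitK (inl i)). Qed.

Lemma perm_sumr (s : 'S_p) (t : 'S_q) i : perm_sum s t (rshift p i) = rshift p (t i).
Proof. by rewrite permE /perm_sum_fun (unsplitK (inr i)). Qed.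

Lemma rpartE x : (x \in rpart p q) = (x \notin lpart p q).
Proof.
rewrite -(splitK x); case: (split x) => i /=.
  rewrite [in RHS]imset_f //; apply/negbTE/imsetP => -[j _ /eqP].
  by rewrite eq_lrshift.
rewrite imset_f //; apply/esym/imsetP => -[j _ /eqP].
by rewrite eq_rlshift.
Qed.

Hypotheses (p0 : (0 < p)%N) (q0 : (0 < q)%N).

Let l1 := map (lshift q) (enum 'I_p).
Let l2 := map (@rshift p q) (enum 'I_q).

Lemma mem_lpart x : (x \in lpart p q) = (x \in l1).
Proof.
by apply/imsetP/mapP => [[i _ ->]|[i _ ->]]; exists i; rewrite ?mem_enum.
Qed.

Lemma mem_rpart x : (x \in rpart p q) = (x \in l2).
Proof.
by apply/imsetP/mapP => [[i _ ->]|[i _ ->]]; exists i; rewrite ?mem_enum.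
Qed.

Lemma gamma2_cycs : uniq (flatten [:: l1; l2]) /\ gamma2 p q = cycs [:: l1; l2].
Proof.
have U : uniq (flatten [:: l1; l2]).
  rewrite /= cats0 cat_uniq (map_inj_uniq (@lshift_inj _ _)).
  rewrite (map_inj_uniq (@rshift_inj _ _)) !enum_uniq andbT /=.
  by apply/hasPn => x; rewrite -mem_rpart rpartE -mem_lpart.
split=> //; apply: eq_cycs => // [l|x]; last first.
  by rewrite /= cats0 mem_cat -mem_lpart -mem_rpart rpartE orbN.
rewrite !inE => /orP[]/eqP->; rewrite cycle_map.
  rewrite -(eq_cycle (e := frel (gamma p))) ?gamma_fcycle // => i j /=.
  by rewrite perm_suml (inj_eq (@lshift_inj _ _)).
rewrite -(eq_cycle (e := frel (gamma q))) ?gamma_fcycle // => i j /=.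
by rewrite perm_sumr (inj_eq (@rshift_inj _ _)).
Qed.

Lemma card_porbits_gamma2 : #|porbits (gamma2 p q)| = 2%N.
Proof.
have [U gE] := gamma2_cycs.
have pl x : x \in lpart p q -> porbit (gamma2 p q) x = lpart p q.
  rewrite mem_lpart => xl; apply/setP => y; rewrite gE mem_lpart.
  by apply: (porbit_cycs U) => //; rewrite inE eqxx.
have pr x : x \in rpart p q -> porbit (gamma2 p q) x = rpart p q.
  rewrite mem_rpart => xl; apply/setP => y; rewrite gE mem_rpart.
  by apply: (porbit_cycs U) => //; rewrite !inE eqxx orbT.
have i1 : lshift q (Ordinal p0) \in lpart p q by apply: imset_f.
have i2 : rshift p (Ordinal q0) \in rpart p q by apply: imset_f.
have -> : porbits (gamma2 p q) = [set lpart p q; rpart p q].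
  apply/setP => c; rewrite !inE; apply/imsetP/orP => [[x _ ->]|[]/eqP->].
  - have [xl|] := boolP (x \in lpart p q); first by left; rewrite pl.
    by rewrite -rpartE => xr; right; rewrite pr.
  - by exists (lshift q (Ordinal p0)); rewrite ?pl.
  by exists (rshift p (Ordinal q0)); rewrite ?pr.
by rewrite cards2; case: eqP => // E; have := i2; rewrite rpartE E i2.
Qed.

(** As [gamma2 p q] has two cycles, the Euler condition is [defect 1]; and some cycle meets both
    parts exactly when some point of the left part is sent to the right one. *)
Lemma card_S_NC : #|S_NC p q| = annular p q.
Proof.
have [U gE] := gamma2_cycs.
have [s1 s2] : size l1 = p /\ size l2 = q by split; rewrite size_map size_enum_ord.
have := joining_count U; rewrite big_nil muln1 s1 s2 => <-.
apply: eq_card => s; rewrite joiningE -gE inE andbC; congr (_ && _).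
  rewrite inE card_porbits_gamma2 card_ord; apply/eqP/eqP; lia.
apply/exists_inP/hasP => [[c /imsetP[x _ ->] /andP[/set0Pn[a] + /set0Pn[b]]]|[x xl sx]].
  rewrite !inE => /andP[ax al] /andP[bx br]; apply/hasP.
  apply: contraTT br => /hasPn H; rewrite rpartE negbK.
  have ba : b \in porbit s a by apply: porbit_trans bx; rewrite porbit_sym.
  apply: (mem_porbit_closed (A := [in lpart p q]) _ ba al) => z /=.
  by rewrite mem_lpart => /H; rewrite -mem_rpart rpartE negbK.
exists (porbit s x); first exact: imset_f.
apply/andP; split; apply/set0Pn.
  by exists x; rewrite inE porbit_id mem_lpart.
by exists (s x); rewrite inE perm_in_porbit mem_rpart.
Qed.
End AnnularCount.

Local Open Scope ring_scope.

(** * The rational series *)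

Section PowerSeriesIdentity.
Variable C : fieldType.
Implicit Types f g : fps2 C.

Lemma fps2_one_mul f : fps2_mul fps2_one f =2 f.
Proof.
move=> m n; rewrite /fps2_mul (bigD1 ord0) //= (bigD1 ord0) //= /fps2_one /= mul1r !subn0.
rewrite big1 => [|j /negPf]; last by rewrite -val_eqE /= => ->; rewrite mul0r.
rewrite addr0 big1 ?addr0 // => i /negPf; rewrite -val_eqE /= => ->.
by rewrite big1 // => j _; rewrite mul0r.
Qed.

Lemma fps2_z_mul f m n : fps2_mul fps2_z f m n = if m is m'.+1 then f m' n else 0.
Proof.
case: m => [|m].
  by rewrite /fps2_mul big_ord1 big1 // => j _; rewrite /fps2_z mul0r.
rewrite /fps2_mul (bigD1 (lift ord0 ord0)) //= (bigD1 ord0) //= /fps2_z /= mul1r.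
rewrite subSS !subn0 big1 => [|j /negPf]; last first.
  by rewrite -val_eqE /= => ->; rewrite mul0r.
rewrite addr0 big1 ?addr0 // => i /negPf; rewrite -val_eqE /= => ->.
by rewrite big1 // => j _; rewrite mul0r.
Qed.

Lemma fps2_w_mul f m n : fps2_mul fps2_w f m n = if n is n'.+1 then f m n' else 0.
Proof.
case: n => [|n].
  by rewrite /fps2_mul big1 // => i _; rewrite big_ord1 /fps2_w /= andbF mul0r.
rewrite /fps2_mul (bigD1 ord0) //= (bigD1 (lift ord0 ord0)) //= /fps2_w /= mul1r.
rewrite subSS !subn0 big1 => [|j /negPf]; last first.
  by rewrite -val_eqE /= => ->; rewrite mul0r.
rewrite addr0 big1 ?addr0 // => i /negPf; rewrite -val_eqE /= => ->.
by rewrite big1 // => j _; rewrite mul0r.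
Qed.

Lemma fps2_mulBl f g h m n : fps2_mul (fps2_sub f g) h m n = fps2_mul f h m n - fps2_mul g h m n.
Proof.
rewrite /fps2_mul -sumrB; apply: eq_bigr => i _; rewrite -sumrB.
by apply: eq_bigr => j _; rewrite mulrBl.
Qed.

Let d : fps2 C := fps2_sub (fps2_sub fps2_one fps2_z) fps2_w.

Lemma fps2_d_mul f m n : fps2_mul d f m n =
  f m n - (if m is m'.+1 then f m' n else 0) - (if n is n'.+1 then f m n' else 0).
Proof. by rewrite !fps2_mulBl fps2_one_mul fps2_z_mul fps2_w_mul. Qed.

(** Multiplication by d combines index shifts, and each shift passes through the product with g. *)
Lemma fps2_d_mulA f g m n : fps2_mul (fps2_mul d f) g m n = fps2_mul d (fps2_mul f g) m n.
Proof.
have zA : fps2_mul (fun m n => if m is m'.+1 then f m' n else 0) g m n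
   = if m is m'.+1 then fps2_mul f g m' n else 0.
  rewrite /fps2_mul big_ord_recl big1 ?add0r => [|j _]; last by rewrite mul0r.
  by case: m => [|m]; rewrite ?big_ord0.
have wA : fps2_mul (fun m n => if n is n'.+1 then f m n' else 0) g m n
   = if n is n'.+1 then fps2_mul f g m n' else 0.
  rewrite /fps2_mul; under eq_bigr => i _ do rewrite big_ord_recl mul0r add0r.
  case: n {zA} => [|n] //.
  by rewrite big1 // => i _; rewrite big_ord0.
rewrite fps2_d_mul -zA -wA -!fps2_mulBl; apply: eq_bigr => i _; apply: eq_bigr => j _.
by rewrite fps2_d_mul.
Qed.

(** By uniqueness of the quotient it suffices to multiply by d twice. By Pascal's rule the first
    product has coefficients ['C(m + n, m)] at (m+1,n+1), and the second leaves zw. *)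
Lemma fps2_quotient : fps2_div (fps2_mul fps2_z fps2_w) (fps2_mul d d) =2
  (fun p q => if (0 < p)%N && (0 < q)%N then (p * 'C(p + q - 1, p))%N%:R else 0).
Proof.
set G := (X in _ =2 X).
(* Two forms of G without the positivity test: at m = 0 the factor m vanishes in [G1], at n = 0 the
   binomial vanishes in [G2]. *)
have G1 m n : G m n.+1 = (m * 'C(m + n, m))%N%:R.
  by rewrite /G; case: m => [|m] //=; rewrite addSn addnS subSS subn0.
have G2 m n : G m.+1 n = (m.+1 * 'C(m + n, m.+1))%N%:R.
  rewrite /G; case: n => [|n] /=; first by rewrite addn0 bin_small ?muln0.
  by rewrite addSn subSS subn0.
have G0 n : G 0%N n = 0 by [].
have dG0 n : fps2_mul d G 0%N n = 0.
  by rewrite fps2_d_mul; case: n => [|n]; rewrite !G0 !subr0.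
have dGn0 m : fps2_mul d G m 0%N = 0.
  by rewrite fps2_d_mul /G; case: m => [|m]; rewrite !andbF !subr0.
have dG m n : fps2_mul d G m.+1 n.+1 = 'C(m + n, m)%:R.
  rewrite fps2_d_mul G1 G2 G1 addSn binS !natrM natrD; ring.
have d0 : fps2_mul d d 0%N 0%N != 0.
  by rewrite fps2_d_mul /d /fps2_sub /fps2_one /fps2_z /fps2_w /= !subr0 oner_neq0.
move=> m n; symmetry; move: m n; apply: fps2_div_uniq => // m n.
rewrite fps2_d_mulA fps2_d_mul fps2_z_mul /fps2_w.
case: m => [|m]; first by rewrite dG0 subr0; case: n => [|n]; rewrite ?dG0 subr0.
case: n => [|n]; first by rewrite dGn0 andbF; case: m => [|m]; rewrite ?dG0 ?dGn0 !subr0.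
rewrite dG; case: m => [|m]; case: n => [|n] /=; rewrite ?dG0 ?dGn0 ?dG ?subr0.
- by rewrite bin0.
- by rewrite !bin0 subrr.
- by rewrite !addn0 !binn subrr.
rewrite addSn !addnS binS natrD; ring.
Qed.

End PowerSeriesIdentity.

(** * Cumulants of a = x^2 *)

Section Moments.
Variable C : numFieldType.

Lemma sc_phi_Xn n : sc_phi ('X^n : {poly C}) = sc_moment C n.
Proof.
rewrite /sc_phi size_polyXn big_ord_recr /= coefXn eqxx mul1r big1 ?add0r // => i _.
by rewrite coefXn ltn_eqF ?mul0r.
Qed.

Lemma sc_phi2_Xn m n : sc_phi2 ('X^m : {poly C}) 'X^n = sc_moment2 C m n.
Proof.
rewrite /sc_phi2 !size_polyXn big_ord_recr /= big1 ?add0r => [|i _]; last first.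
  by rewrite big1 // => j _; rewrite coefXn ltn_eqF ?mul0r.
rewrite big_ord_recr /= !coefXn !eqxx !mul1r big1 ?add0r // => j _.
by rewrite !coefXn (ltn_eqF (ltn_ord j)) mulr0 mul0r.
Qed.

Lemma sc_moment_double n : sc_moment C n.*2 = (catalan n)%:R.
Proof.
rewrite /sc_moment odd_double doubleK; have := ballot_mul n 0.
rewrite addn0 addn1 mul1n => <-.
by rewrite natrM mulrAC divff ?mul1r // pnatr_eq0.
Qed.

Lemma half_bin_double n k : half_bin n.*2 k = if odd k then 0%N else 'C(n.*2, n + k./2).
Proof.
rewrite /half_bin; case: ifP => [/andP[le_k]|].
  rewrite oddB // odd_double /= => /negPf ko; rewrite ko -[RHS]bin_sub; last by lia.
  by congr 'C(_, _); lia.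
case: ifP => // ko; case: leqP => //= [le_k|lt_k _]; last by rewrite bin_small //; lia.
by rewrite oddB // odd_double ko.
Qed.

Lemma sum_odd_zero (F : nat -> nat) p : (forall k, odd k -> F k = 0%N) ->
  (\sum_(k < p.*2.+1) F k = \sum_(j < p.+1) F j.*2)%N.
Proof.
move=> F0; elim: p => [|p IH]; first by rewrite !big_ord1.
rewrite doubleS big_ord_recr big_ord_recr /= IH [RHS]big_ord_recr /= F0 ?addn0 //=.
by rewrite odd_double.
Qed.

(** Only even k = 2j contribute, and the weight k supplies the factor 2. *)
Lemma sc_moment2_double p q : (0 < p)%N -> (0 < q)%N ->
  sc_moment2 C p.*2 q.*2 = (annular p q).*2%:R.
Proof.
move=> p0 q0; rewrite /sc_moment2 oddD !odd_double !double_eq0 !eqn0Ngt p0 q0 /=.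
congr _%:R; set F := fun k => (k * half_bin p.*2 k * half_bin q.*2 k)%N.
have -> : (\sum_(1 <= k < p.*2.+1) F k = \sum_(k < p.*2.+1) F k)%N.
  by rewrite -(big_mkord xpredT F) [RHS]big_ltn // {2}/F !mul0n.
rewrite sum_odd_zero => [|k ko]; last by rewrite /F !half_bin_double ko muln0.
rewrite /annular -mul2n big_distrr /=; apply: eq_bigr => j _.
by rewrite /F !half_bin_double odd_double doubleK -mul2n -!mulnA.
Qed.

End Moments.

(** * First order cumulants of a *)

Section FirstOrder.
Variables (C : numFieldType) (kappa : seq {poly C} -> C).
Hypothesis kappaP : free_cumulants (@sc_phi C) kappa.
Let a : {poly C} := 'X^2.

Lemma card_porbits1_eq (T : finType) (u : {perm T}) : #|porbits u| = #|T| -> u = 1%g.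
Proof.
move=> uT; apply/permP => x; rewrite perm1; apply/eqP; apply: contraT => ux.
have := card_porbits_unhook ux; rewrite uT => E.
by have := leq_imset_card (porbit (u * tperm x (u x))%g) T; rewrite -/(porbits _) E ltnn.
Qed.

Lemma gamma_NC n : gamma n \in NC n.
Proof. by rewrite NC_defect inE mulgV card_porbits1 addn0 addnC. Qed.

Lemma card_porbits_gamma n : (0 < n)%N -> porbits (gamma n) = [set setT].
Proof.
move=> n0; have pT x : porbit (gamma n) x = setT.
  apply/setP => y; rewrite (porbit_fcycle (gamma_fcycle n)) ?mem_enum //.
  by rewrite !inE.
apply/setP => c; rewrite inE; apply/imsetP/eqP => [[x _ ->]//|->].
by exists (Ordinal n0).
Qed.

(** If s has a single cycle, defect 0 forces [gamma n * s^-1] to have n cycles, hence to be 1. *)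
Lemma NC_cycle_full n (s : 'S_n) c : s \in NC n -> c \in porbits s -> #|c| = n -> s = gamma n.
Proof.
move=> sNC cs cn; have n0 : (0 < n)%N.
  by case/imsetP: cs => x _ _; apply: leq_ltn_trans (ltn_ord x).
have cT : c = setT by apply/eqP; rewrite eqEcard subsetT cardsT card_ord cn leqnn.
have sT : porbits s = [set setT].
  apply/setP => d; rewrite inE; apply/idP/eqP => [/imsetP[x _ ->]|->]; last by rewrite -cT.
  case/imsetP: cs => y _; rewrite cT => yT.
  have : x \in porbit s y by rewrite -yT inE.
  by rewrite -eq_porbit_mem => /eqP ->.
move: sNC; rewrite NC_defect inE sT card_porbits_gamma // addn0 addnC cards1.
rewrite eqn_add2r => /eqP/card_porbits1_eq /(congr1 (mulg^~ s)).
by rewrite mulgKV mul1g.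
Qed.

Lemma map_const (T U : Type) (x : U) (r : seq T) : [seq x | _ <- r] = nseq (size r) x.
Proof. by elim: r => //= y r ->. Qed.

Lemma size_cycle_seq n (s : 'S_n) c : c \in porbits s -> size (cycle_seq s c) = #|c|.
Proof. by case/cycle_seqE => i [_ _ ->]; rewrite size_traject. Qed.

Lemma kappa_cycle_const n (s : 'S_n) c : c \in porbits s ->
  kappa_cycle kappa (fun=> a) s c = kappa (nseq #|c| a).
Proof. by move=> cs; rewrite /kappa_cycle map_const size_cycle_seq. Qed.

Lemma porbits_card_gt0 n (s : 'S_n) c : c \in porbits s -> (0 < #|c|)%N.
Proof. by case/imsetP => x _ ->; rewrite lt0n card_porbit_neq0. Qed.

Lemma kappa_nseq n : (0 < n)%N -> kappa (nseq n a) = 1.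
Proof.
have [m] := ubnP n; elim: m n => // m IH n /ltnSE le_n n0.
have := kappaP (fun=> a) n0.
rewrite prodr_const card_ord -exprM mul2n sc_phi_Xn sc_moment_double.
rewrite (bigD1 (gamma n)) ?gamma_NC //= /kappa_perm card_porbits_gamma // big_set1.
rewrite kappa_cycle_const ?card_porbits_gamma ?inE // cardsT card_ord.
rewrite (eq_bigr (fun=> 1)) => [|s /andP[sNC sg]]; last first.
  apply: big1 => c cs; rewrite kappa_cycle_const //; apply: IH; last exact: porbits_card_gt0 cs.
  apply: leq_trans le_n; rewrite ltn_neqAle; apply/andP; split; last first.
    by have := max_card [in c]; rewrite card_ord.
  by apply: contraNneq sg => cn; apply/eqP/(NC_cycle_full sNC cs).
rewrite sumr_const => E.
have : #|[pred s in NC n | s != gamma n]| = (catalan n).-1.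
  have := cardsD1 (gamma n) (NC n); rewrite gamma_NC card_NC add1n => ->.
  by rewrite /=; apply: eq_card => s; rewrite !inE andbC.
rewrite (eq_card (B := fun s => (s \in NC n) && (s != gamma n))) // => card.
rewrite card in E; have c0 : (0 < catalan n)%N.
  by rewrite -card_NC (cardsD1 (gamma n)) gamma_NC.
apply: (addIr (catalan n).-1%:R); rewrite -[LHS]E nat1r.
by rewrite prednK.
Qed.

End FirstOrder.

(** * PS_NC(p,q)' parametrised by pairs of cycles *)

Section MergedPartitions.
Variables (p q : nat) (u : 'S_(p + q)).

Let L := [set c in porbits u | c \subset lpart p q].
Let R := [set c in porbits u | c \subset rpart p q].

(** Over a fixed u in [NC2 p q], an element of [PS_NC' p q] amounts to the choice of the two cycles
    in its exceptional block. *)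
Definition merge_cycles (cd : {set 'I_(p + q)} * {set 'I_(p + q)}) : {set {set 'I_(p + q)}} :=
  (cd.1 :|: cd.2) |: (porbits u :\: [set cd.1; cd.2]).

Lemma porbits_eq (T : finType) (s : {perm T}) c d x : c \in porbits s -> d \in porbits s ->
  x \in c -> x \in d -> c = d.
Proof.
move=> /imsetP[y _ ->] /imsetP[z _ ->]; rewrite -!eq_porbit_mem => /eqP <-.
by move/eqP.
Qed.

Lemma porbits_neq0 (T : finType) (s : {perm T}) c : c \in porbits s -> exists x, x \in c.
Proof. by case/imsetP => x _ ->; exists x; apply: porbit_id. Qed.

Lemma cycles_in_porbit n (s : 'S_n) c : c \in porbits s -> cycles_in s c = [set c].
Proof.
move=> cs; apply/setP => d; rewrite !inE; apply/andP/eqP => [[ds dc]|->//].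
have [x xd] := porbits_neq0 ds.
exact: porbits_eq ds cs xd (subsetP dc x xd).
Qed.

Lemma cycles_in_setU c d : c \in porbits u -> d \in porbits u ->
  cycles_in u (c :|: d) = [set c; d].
Proof.
move=> cu du; apply/setP => e; rewrite !inE; apply/andP/orP => [[eu /subsetP ecd]|].
  have [x xe] := porbits_neq0 eu; have := ecd x xe; rewrite inE => /orP[xc|xd].
    by left; apply/eqP; exact: porbits_eq eu cu xe xc.
  by right; apply/eqP; exact: porbits_eq eu du xe xd.
by case=> /eqP->; rewrite ?cu ?du ?subsetUl ?subsetUr.
Qed.

Lemma LR_neq c d : c \in L -> d \in R -> c != d.
Proof.
rewrite !inE => /andP[cu /subsetP cl] /andP[du /subsetP dr]; apply/eqP => cd.
have [x xc] := porbits_neq0 cu; have := cl x xc; have := dr x; rewrite -cd => /(_ xc).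
by rewrite rpartE => /negPf ->.
Qed.

Lemma L_notR c : c \in porbits u -> c \subset lpart p q -> c \subset rpart p q = false.
Proof.
move=> cu cl; apply/negP => cr; have := @LR_neq c c; rewrite !inE cu cl cr eqxx.
by move=> /(_ isT isT).
Qed.

Lemma merge_cyclesP c d : c \in L -> d \in R ->
  (merge_cycles (c, d), u) \in PS_NC' p q = (u \in NC2 p q).
Proof.
move=> cL dR; have := LR_neq cL dR; move: (cL) (dR).
rewrite !inE => /andP[cu cl] /andP[du dr] ncd; case: (u \in NC2 p q) => //=.
set V := merge_cycles _.
have cV : c :|: d \in V by rewrite /V /merge_cycles !inE eqxx.
have subV e : e \in porbits u -> exists2 B, B \in V & e \subset B.
  move=> eu; case: (boolP (e \in [set c; d])) => [|eN].
    by rewrite !inE => /orP[]/eqP->; exists (c :|: d) => //; rewrite ?subsetUl ?subsetUr.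
  by exists e => //; rewrite /V /merge_cycles in_setU1 in_setD eN eu orbT.
have porV D : D \in V -> D != c :|: d -> [/\ D \in porbits u, D != c & D != d].
  rewrite /V /merge_cycles in_setU1 in_setD => /predU1P[->|/andP[+ Du] _]; first by rewrite eqxx.
  by rewrite !inE negb_or => /andP[].
have disj D x : D \in porbits u -> D != c -> D != d -> x \in D -> x \notin c :|: d.
  move=> Du Dc Dd xD; rewrite inE; apply/orP => -[xc|xd].
    by rewrite (porbits_eq Du cu xD xc) eqxx in Dc.
  by rewrite (porbits_eq Du du xD xd) eqxx in Dd.
apply/andP; split.
  apply/andP; split; last first.
    by apply/forall_inP => e /subV[B BV eB]; apply/exists_inP; exists B.
  apply/and3P; split.
  - apply/eqP/setP => x; rewrite inE; have [B BV /subsetP xB] := subV _ (mem_porbits u x).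
    by apply/bigcupP; exists B => //; apply/xB/porbit_id.
  - apply/trivIsetP => A B AV BV AB; rewrite -setI_eq0; apply/eqP/setP => x; rewrite !inE.
    apply/negP => /andP[xA xB].
    have [AE|AN] := eqVneq A (c :|: d).
      have [Bu Bc Bd] : [/\ B \in porbits u, B != c & B != d].
        by apply: porV; rewrite // -AE eq_sym.
      by have := disj _ _ Bu Bc Bd xB; rewrite -AE xA.
    have [Au Ac Ad] := porV _ AV AN.
    have [BE|BN] := eqVneq B (c :|: d); first by have := disj _ _ Au Ac Ad xA; rewrite -BE xB.
    have [Bu _ _] := porV _ BV BN.
    by rewrite (porbits_eq Au Bu xA xB) eqxx in AB.
  - apply/negP => V0; have [E|N] := eqVneq (set0 : {set 'I_(p + q)}) (c :|: d).
      have [x xc] := porbits_neq0 cu.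
      by have : x \in c :|: d := subsetP (subsetUl _ _) x xc; rewrite -E inE.
    by have [/porbits_neq0[x]] := porV _ V0 N; rewrite inE.
apply/exists_inP; exists (c :|: d) => //; rewrite cycles_in_setU // cards2 ncd /=.
have dl : d \subset lpart p q = false.
  by apply/negP => dl; have := L_notR du dl; rewrite dr.
have -> : [set e in [set c; d] | e \subset lpart p q] = [set c].
  apply/setP => e; rewrite !inE; case: (eqVneq e c) => [->|_] /=; first by rewrite cl.
  by case: (eqVneq e d) => [->|//]; rewrite dl.
have -> : [set e in [set c; d] | e \subset rpart p q] = [set d].
  apply/setP => e; rewrite !inE; case: (eqVneq e d) => [->|_] /=; first by rewrite dr orbT.
  by rewrite orbF; case: (eqVneq e c) => [->|//]; rewrite L_notR.
rewrite !cards1 /=; apply/forall_inP => D DV; apply/implyP => DN.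
by have [Du _ _] := porV _ DV DN; rewrite cycles_in_porbit // cards1.
Qed.

(** The exceptional block is the only one that is not a cycle of u, and its traces on the two parts
    are c and d. *)
Lemma merge_cycles_inj : {in setX L R &, injective merge_cycles}.
Proof.
move=> [c d] [c' d']; rewrite !in_setX /= => /andP[cL dR] /andP[cL' dR'] E.
have part a b : a \in L -> b \in R ->
    a = (a :|: b) :&: lpart p q /\ b = (a :|: b) :&: rpart p q.
  rewrite !inE => /andP[_ /subsetP al] /andP[_ /subsetP br].
  split; apply/setP => x; rewrite !inE ?rpartE.
    have [xa|_] := boolP (x \in a); first by rewrite al.
    by have [/br|//] := boolP (x \in b); rewrite rpartE => /negPf->.
  have [xb|_] := boolP (x \in b); first by rewrite orbT -rpartE br.
  by rewrite orbF; have [/al->|//] := boolP (x \in a).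
have : c :|: d \in merge_cycles (c', d') by rewrite -E !inE eqxx.
rewrite /merge_cycles in_setU1 in_setD /= => /predU1P[U|/andP[_ cdu]].
  have [c1 d1] := part _ _ cL dR; have [c2 d2] := part _ _ cL' dR'.
  by congr (_, _); [rewrite c1 U -c2 | rewrite d1 U -d2].
have := cycles_in_porbit cdu; rewrite cycles_in_setU; first last.
- by move: dR; rewrite inE => /andP[].
- by move: cL; rewrite inE => /andP[].
move/(congr1 (fun A : {set {set 'I_(p + q)}} => #|A|)).
by rewrite cards1 cards2 LR_neq.
Qed.

Lemma merge_cycles_surj V : (V, u) \in PS_NC' p q -> V \in merge_cycles @: setX L R.
Proof.
rewrite inE /= => /and3P[_ /andP[part /forall_inP sub]].
case/exists_inP => B BV /and4P[/eqP B2 /cards1P[c cE] /cards1P[d dE] /forall_inP one].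
have [cB cu cl] : [/\ c \subset B, c \in porbits u & c \subset lpart p q].
  by have := set11 c; rewrite -cE !inE => /andP[/andP[]].
have [dB du dr] : [/\ d \subset B, d \in porbits u & d \subset rpart p q].
  by have := set11 d; rewrite -dE !inE => /andP[/andP[]].
have cL : c \in L by rewrite inE cu.
have dR : d \in R by rewrite inE du.
case/and3P: part => /eqP cov /trivIsetP triv V0.
have blockP D x : D \in V -> x \in D -> porbit u x \subset D.
  move=> DV xD; have /exists_inP[D' D'V xD'] := sub _ (mem_porbits u x).
  have [->//|/(triv _ _ DV D'V)] := eqVneq D D'.
  rewrite -setI_eq0 => /eqP/setP/(_ x); rewrite !inE xD.
  by rewrite (subsetP xD') ?porbit_id.
have BE : cycles_in u B = [set c; d].
  apply/eqP; rewrite eq_sym eqEcard B2 cards2 (LR_neq cL dR) andbT.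
  by apply/subsetP => e; rewrite !inE => /orP[]/eqP->; rewrite ?cu ?du ?cB ?dB.
have Bcd : B = c :|: d.
  apply/eqP; rewrite eqEsubset subUset cB dB !andbT; apply/subsetP => x xB.
  have : porbit u x \in cycles_in u B by rewrite inE mem_porbits blockP.
  by rewrite BE !inE => /orP[]/eqP <-; rewrite porbit_id ?orbT.
have oneP D : D \in V -> D != B -> cycles_in u D = [set D] /\ D \in porbits u.
  move=> DV DB; have /cards1P[e eE] : #|cycles_in u D| == 1 by have := one D DV; rewrite DB.
  have [eD eu] : e \subset D /\ e \in porbits u.
    by have := set11 e; rewrite -eE inE => /andP[].
  suff <- : e = D by split=> //; apply: cycles_in_porbit.
  apply/eqP; rewrite eqEsubset eD; apply/subsetP => x xD.
  have : porbit u x \in cycles_in u D by rewrite inE mem_porbits blockP.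
  by rewrite eE inE => /eqP <-; apply: porbit_id.
apply/imsetP; exists (c, d); first by rewrite in_setX cL.
apply/setP => D; rewrite /merge_cycles /= in_setU1 in_setD -Bcd.
have [->|DB] /= := eqVneq D B; first by rewrite BV.
apply/idP/andP => [DV|[DN Du]].
  have [DE Du] := oneP D DV DB; split=> //; rewrite !inE.
  have [x xD] := porbits_neq0 Du; have xB : x \notin B.
    apply/negP => xB; have := triv _ _ DV BV DB; rewrite -setI_eq0 => /eqP/setP/(_ x).
    by rewrite !inE xD xB.
  apply/norP; split; apply: contra xB => /eqP E; rewrite -?E in xD *.
    by apply: (subsetP cB); rewrite -E.
  by apply: (subsetP dB); rewrite -E.
have /exists_inP[D' D'V DD'] := sub _ Du.
have D'B : D' != B.
  apply: contraNneq DN => D'B; have : D \in cycles_in u B by rewrite inE Du -D'B.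
  by rewrite BE.
have [D'E _] := oneP D' D'V D'B.
have : D \in cycles_in u D' by rewrite inE Du.
by rewrite D'E inE => /eqP ->.
Qed.

End MergedPartitions.

Section SumOverMergedPartitions.
Variables p q : nat.
Implicit Types (s : 'S_p) (t : 'S_q).

Lemma porbit_perm_suml s t i :
  porbit (perm_sum s t) (lshift q i) = lshift q @: porbit s i.
Proof.
have E k : (perm_sum s t ^+ k)%g (lshift q i) = lshift q ((s ^+ k)%g i).
  by rewrite !permX; elim: k => //= k ->; rewrite perm_suml.
apply/setP => x; apply/porbitP/imsetP => [[k ->]|[j /porbitP[k ->] ->]].
  by exists ((s ^+ k)%g i); rewrite ?mem_porbit // E.
by exists k; rewrite E.
Qed.

Lemma porbit_perm_sumr s t i :
  porbit (perm_sum s t) (rshift p i) = @rshift p q @: porbit t i.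
Proof.
have E k : (perm_sum s t ^+ k)%g (rshift p i) = rshift p ((t ^+ k)%g i).
  by rewrite !permX; elim: k => //= k ->; rewrite perm_sumr.
apply/setP => x; apply/porbitP/imsetP => [[k ->]|[j /porbitP[k ->] ->]].
  by exists ((t ^+ k)%g i); rewrite ?mem_porbit // E.
by exists k; rewrite E.
Qed.

Lemma porbits_perm_suml s t :
  [set c in porbits (perm_sum s t) | c \subset lpart p q]
    = [set lshift q @: (c : {set 'I_p}) | c in porbits s].
Proof.
apply/setP => c; rewrite inE; apply/andP/imsetP.
  case=> /imsetP[x _ ->] /subsetP/(_ x (porbit_id _ _))/imsetP[i _ ->].
  by exists (porbit s i); rewrite ?mem_porbits ?porbit_perm_suml.
case=> _ /imsetP[i _ ->] ->; rewrite -(porbit_perm_suml s t) mem_porbits; split=> //.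
by rewrite porbit_perm_suml; apply/imsetS/subsetP.
Qed.

Lemma porbits_perm_sumr s t :
  [set c in porbits (perm_sum s t) | c \subset rpart p q]
    = [set @rshift p q @: (c : {set 'I_q}) | c in porbits t].
Proof.
apply/setP => c; rewrite inE; apply/andP/imsetP.
  case=> /imsetP[x _ ->] /subsetP/(_ x (porbit_id _ _))/imsetP[i _ ->].
  by exists (porbit t i); rewrite ?mem_porbits ?porbit_perm_sumr.
case=> _ /imsetP[i _ ->] ->; rewrite -(porbit_perm_sumr s t) mem_porbits; split=> //.
by rewrite porbit_perm_sumr; apply/imsetS/subsetP.
Qed.

Lemma perm_sum_inj2 s s' t t' : perm_sum s t = perm_sum s' t' -> s = s' /\ t = t'.
Proof.
move=> E; split; apply/permP => i.
  by apply: (@lshift_inj p q); rewrite -(perm_suml s t) E perm_suml.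
by apply: (@rshift_inj p q); rewrite -(perm_sumr s t) E perm_sumr.
Qed.

Lemma sum_PS_NC' (C : nmodType) (f : {set {set 'I_(p + q)}} * 'S_(p + q) -> C) :
  \sum_(x in PS_NC' p q) f x =
  \sum_(s in NC p) \sum_(t in NC q) \sum_(c in porbits s) \sum_(d in porbits t)
     f (merge_cycles (perm_sum s t) (lshift q @: c, @rshift p q @: d), perm_sum s t).
Proof.
rewrite (partition_big snd [in NC2 p q]) => [|x]; last by rewrite inE => /and3P[].
have -> : NC2 p q = (fun st => perm_sum st.1 st.2) @: setX (NC p) (NC q).
  apply/setP => u; apply/imset2P/imsetP => [[s t sN tN ->]|[[s t] + ->]].
    by exists (s, t); rewrite // in_setX sN.
  by rewrite in_setX => /andP[sN tN]; exists s t.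
rewrite big_imset /=; last first.
  by move=> [s t] [s' t'] _ _ /= /perm_sum_inj2[-> ->].
rewrite [RHS]pair_big_dep /= [LHS](eq_bigl (fun st => (st.1 \in NC p) && (st.2 \in NC q))); last first.
  by move=> [s t]; rewrite in_setX.
apply: eq_bigr => -[s t] /= /andP[sN tN]; set u := perm_sum s t.
have uN : u \in NC2 p q by apply/imset2P; exists s t.
transitivity (\sum_(cd in setX [set c in porbits u | c \subset lpart p q]
    [set c in porbits u | c \subset rpart p q]) f (merge_cycles u cd, u)).
  rewrite -(big_imset (h := fun cd => (merge_cycles u cd, u)) f) /=; last first.
    by move=> cd cd' H H' [] /(merge_cycles_inj H H').
  apply: eq_bigl => -[V v] /=; apply/andP/imsetP => [[+ /eqP vu]|[[c d] + [-> ->]]].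
    by rewrite vu => /merge_cycles_surj/imsetP[cd H ->]; exists cd.
  by rewrite in_setX => /andP[cL dR]; rewrite merge_cyclesP ?eqxx.
transitivity (\sum_(c in [set c in porbits u | c \subset lpart p q])
    \sum_(d in [set c in porbits u | c \subset rpart p q]) f (merge_cycles u (c, d), u)).
  rewrite pair_big_dep /=; apply: eq_big => [[c d]|[c d] _] //=.
  by rewrite in_setX.
rewrite porbits_perm_suml big_imset /=; last by move=> c d _ _; apply/imset_inj/lshift_inj.
apply: eq_bigr => c _; rewrite porbits_perm_sumr big_imset //=.
by move=> d d' _ _; apply/imset_inj/rshift_inj.
Qed.

End SumOverMergedPartitions.

(** * The unitriangular system for the second order cumulants *)

Section SecondOrder.
Variables (C : numFieldType) (kappa : seq {poly C} -> C).
Variable kappa2 : seq {poly C} -> seq {poly C} -> C.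
Hypothesis kappaP : free_cumulants (@sc_phi C) kappa.
Hypothesis kappa2P : second_order_cumulants (@sc_phi2 C) kappa kappa2.
Let a : {poly C} := 'X^2.
Let K m l := kappa2 (nseq m a) (nseq l a).

Lemma kappa_cycle1 n (s : 'S_n) c : c \in porbits s -> kappa_cycle kappa (fun=> a) s c = 1.
Proof. by move=> cs; rewrite kappa_cycle_const // kappa_nseq // (porbits_card_gt0 cs). Qed.

Lemma kappa_block1 p q (u : 'S_(p + q)) B : B \in porbits u ->
  kappa_block kappa kappa2 (fun=> a) u B = 1.
Proof. by move=> Bu; rewrite /kappa_block cycles_in_porbit // enum_set1 kappa_cycle1. Qed.

Lemma kappa_pperm_merge p q (u : 'S_(p + q)) c d :
    c \in [set c in porbits u | c \subset lpart p q] ->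
    d \in [set c in porbits u | c \subset rpart p q] ->
  kappa_pperm kappa kappa2 (fun=> a) (merge_cycles u (c, d), u) = K #|c| #|d|.
Proof.
move=> cL dR; have ncd := LR_neq cL dR.
move: cL dR; rewrite !inE => /andP[cu cl] /andP[du dr].
have dl : d \subset lpart p q = false.
  by apply/negP => dl; have := L_notR du dl; rewrite dr.
have cdu : c :|: d \notin porbits u :\: [set c; d].
  rewrite inE; apply/negP => /andP[_ /cycles_in_porbit]; rewrite cycles_in_setU //.
  by move/(congr1 (fun A : {set {set 'I_(p + q)}} => #|A|)); rewrite cards1 cards2 ncd.
rewrite /kappa_pperm /= /merge_cycles /= big_setU1 //= big1 ?mulr1 => [|B]; last first.
  by rewrite inE => /andP[_ Bu]; apply: kappa_block1.
rewrite /kappa_block cycles_in_setU //.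
(* The order of c and d in the enumeration is unknown; the test on [lpart] in [kappa_block] restores
   it. *)
have mE e : e \in enum [set c; d] -> (e == c) || (e == d) by rewrite mem_enum !inE.
have := enum_uniq [set c; d]; have : size (enum [set c; d]) = 2%N.
  by rewrite -cardE cards2 ncd.
case: (enum _) mE => [|e [|f [|? ?]]] // mE _ /=; rewrite inE andbT => nef.
have := mE e (mem_head _ _); have := mE f; rewrite !inE eqxx orbT => /(_ isT).
move=> /orP[]/eqP fE /orP[]/eqP eE; move: nef; rewrite fE eE ?eqxx // => _.
  by rewrite dl !map_const !size_cycle_seq.
by rewrite cl !map_const !size_cycle_seq.
Qed.

Definition block_count n m : nat := (\sum_(s in NC n) blocks_of_size s m)%N.

Lemma sum_blocks n (h : nat -> C) :
  \sum_(s in NC n) \sum_(c in porbits s) h #|c|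
    = \sum_(m < n.+1) (block_count n m)%:R * h m.
Proof.
under [RHS]eq_bigr => m _ do rewrite /block_count natr_sum mulr_suml.
rewrite [RHS]exchange_big /=; apply: eq_bigr => s _.
have le (c : {set 'I_n}) : (#|c| < n.+1)%N by rewrite ltnS; have := max_card [in c]; rewrite card_ord.
rewrite (partition_big (fun c => Ordinal (le c)) predT) //=; apply: eq_bigr => m _.
rewrite (eq_bigr (fun=> h m)) => [|c /andP[_ /eqP <-]//].
rewrite sumr_const mulr_natl; congr (_ *+ _); apply: eq_card => c.
by rewrite inE.
Qed.

Lemma block_count0 n : block_count n 0 = 0%N.
Proof.
apply: big1 => s _; apply: eq_card0 => c; rewrite inE.
by apply/andP => -[/porbits_card_gt0]; case: #|c|.
Qed.

Lemma block_count_id n : (0 < n)%N -> block_count n n = 1%N.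
Proof.
by move=> n0; rewrite /block_count sum_blocks_of_size ?n0 ?leqnn // subnn bin0.
Qed.

(** The factor k extends [block_count_conv] to k = 0. At m = 0 the closed form differs from
    [block_count0], but for k > 0 the binomial is zero there. *)
Lemma sum_block_count_bin n k :
  (\sum_(m < n.+1) block_count n m * (k * 'C(m, k)) = k * 'C(n.*2, n + k))%N.
Proof.
case: k => [|k]; first by rewrite mul0n big1 // => m _; rewrite muln0.
rewrite -block_count_conv // big_distrr /=; apply: eq_bigr => -[[|m] ltm] _ /=.
  by rewrite block_count0 !muln0.
by rewrite mulnCA /block_count sum_blocks_of_size.
Qed.

(** Once [mul_bin_conv] separates m from l, each of the two sums is [sum_block_count_bin]. *)
Lemma annular_block_count p q :
  (\sum_(m < p.+1) \sum_(l < q.+1)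
     block_count p m * block_count q l * (m * 'C(m + l - 1, m)) = annular p q)%N.
Proof.
transitivity (\sum_(m < p.+1) \sum_(l < q.+1) \sum_(k < p.+1)
    (block_count p m * (k * 'C(m, k))) * (block_count q l * 'C(l, k)))%N.
  apply: eq_bigr => m _; apply: eq_bigr => l _.
  rewrite (mul_bin_conv _ (B := p)) -1?ltnS // big_distrr /=; apply: eq_bigr => k _.
  lia.
under eq_bigr => m _ do rewrite exchange_big /=.
rewrite exchange_big /=; apply: eq_bigr => k _.
rewrite -mulnA; under eq_bigr => m _ do rewrite -big_distrr /=.
rewrite -big_distrl /= sum_block_count_bin -mulnA mulnCA [RHS]mulnCA; congr (_ * _)%N.
by rewrite big_distrr -sum_block_count_bin; apply: eq_bigr => l _; rewrite mulnCA.
Qed.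

Lemma S_NC_PS_disjoint p q :
  [disjoint [set (porbits s, s) | s in S_NC p q] & PS_NC' p q].
Proof.
rewrite -setI_eq0; apply/eqP/setP => x; rewrite !inE; apply/negP => /andP[].
case/imsetP => s + -> /=; rewrite inE => /andP[/exists_inP[c + ci] _] /and3P[sN2 _ _].
case/imset2P: sN2 => s1 s2 _ _ sE; rewrite sE => /imsetP[x0 _ cE].
case/andP: ci => /set0Pn[y] + /set0Pn[z]; rewrite !inE cE => /andP[yx yl] /andP[zx].
rewrite rpartE => /negP[].
have zy : z \in porbit (perm_sum s1 s2) y.
  by apply: porbit_trans zx; rewrite porbit_sym.
apply: (mem_porbit_closed (A := [in lpart p q]) _ zy yl) => w /imsetP[i _ ->].
by rewrite /= perm_suml imset_f.
Qed.

Lemma second_order_sum p q : (0 < p)%N -> (0 < q)%N ->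
  \sum_(m < p.+1) \sum_(l < q.+1) (block_count p m * block_count q l)%:R * K m l
    = (annular p q)%:R.
Proof.
move=> p0 q0; have := kappa2P (fun=> a) p0 q0.
rewrite !prodr_const !card_ord -!exprM !mul2n sc_phi2_Xn sc_moment2_double //.
rewrite /PS_NC (eq_bigl [in [predU [set (porbits s, s) | s in S_NC p q] & PS_NC' p q]]);
  last by move=> x; rewrite in_setU.
rewrite bigU ?S_NC_PS_disjoint //=.
rewrite big_imset /=; last by move=> s t _ _ [].
(* Blocks of elements of [S_NC p q] are single cycles, of cumulant 1, so this part is [annular p q]
   and cancels half of the moment. *)
rewrite (eq_bigr (fun=> 1)) => [|s _]; last first.
  by rewrite /kappa_pperm big1 // => B; apply: kappa_block1.
rewrite sumr_const card_S_NC // -addnn natrD => /addrI ->.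
rewrite sum_PS_NC'.
transitivity (\sum_(s in NC p) \sum_(c in porbits s) \sum_(t in NC q)
   \sum_(d in porbits t) K #|c| #|d|); last first.
  apply: eq_bigr => s _; rewrite exchange_big /=; apply: eq_bigr => t _.
  apply: eq_bigr => c cs; apply: eq_bigr => d dt; rewrite kappa_pperm_merge.
  - by rewrite !card_imset //; [apply: rshift_inj | apply: lshift_inj].
  - by rewrite porbits_perm_suml imset_f.
  by rewrite porbits_perm_sumr imset_f.
rewrite (sum_blocks p (fun m => \sum_(t in NC q) \sum_(d in porbits t) K m #|d|)).
apply: eq_bigr => m _; rewrite (sum_blocks q (K m)) big_distrr /=.
by apply: eq_bigr => l _; rewrite natrM mulrA.
Qed.

Lemma second_order_cumulant p q : (0 < p)%N -> (0 < q)%N ->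
  K p q = (p * 'C(p + q - 1, p))%N%:R.
Proof.
have [n] := ubnP (p + q); elim: n p q => // n IH p q /ltnSE le_n p0 q0.
(* D solves the homogeneous system; by induction only the top term survives, with coefficient 1. *)
pose D m l := K m l - (m * 'C(m + l - 1, m))%N%:R.
have : \sum_(m < p.+1) \sum_(l < q.+1) (block_count p m * block_count q l)%:R * D m l = 0.
  transitivity ((annular p q)%:R - (annular p q)%:R : C); last exact: subrr.
  rewrite -{1}second_order_sum // -annular_block_count natr_sum -sumrB.
  apply: eq_bigr => m _; rewrite natr_sum -sumrB; apply: eq_bigr => l _.
  by rewrite mulrBr -natrM.
have D0 m l : (m <= p)%N -> (l <= q)%N -> (m != p) || (l != q) ->
    (block_count p m * block_count q l)%:R * D m l = 0.
  case: m => [|m]; first by rewrite block_count0 mul0r.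
  case: l => [|l]; first by rewrite block_count0 muln0 mul0r.
  move=> le_m le_l ne; rewrite /D IH ?subrr ?mulr0 //.
  by apply: leq_trans le_n; move: ne => /orP[]/eqP; lia.
rewrite big_ord_recr big1 /= => [|m _]; last first.
  rewrite big1 // => l _; apply: D0; first exact: ltnW (ltn_ord m).
    by rewrite -ltnS.
  by rewrite (ltn_eqF (ltn_ord m)).
rewrite add0r big_ord_recr big1 /= => [|l _]; last first.
  apply: D0; [exact: leqnn | exact: ltnW (ltn_ord l) | ].
  by rewrite (ltn_eqF (ltn_ord l)) orbT.
rewrite add0r !block_count_id // mul1r => /eqP.
by rewrite subr_eq0 => /eqP.
Qed.

End SecondOrder.

Theorem theorem31 (R : realType)
    (kappa : seq {poly R[i]} -> R[i])
    (kappa2 : seq {poly R[i]} -> seq {poly R[i]} -> R[i])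
    (hkappa : free_cumulants (@sc_phi R[i]) kappa)
    (hkappa2 : second_order_cumulants (@sc_phi2 R[i]) kappa kappa2) :
  let a : {poly R[i]} := 'X^2 in
  let K : fps2 R[i] := fun p q =>
    if (0 < p)%N && (0 < q)%N then kappa2 (nseq p a) (nseq q a) else 0 in
  let d : fps2 R[i] := fps2_sub (fps2_sub fps2_one fps2_z) fps2_w in
  let F : fps2 R[i] := fps2_div (fps2_mul fps2_z fps2_w) (fps2_mul d d) in
  let G : fps2 R[i] := fun p q =>
    if (0 < p)%N && (0 < q)%N then (p * 'C(p + q - 1, p))%N%:R else 0 in
  K =2 F /\ F =2 G.
Proof.
move=> a K d F G; have FG : F =2 G by apply: fps2_quotient.
split=> // p q; rewrite FG /K /G; case: ifP => // /andP[p0 q0].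
exact: (second_order_cumulant hkappa hkappa2).
Qed.
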